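(* MEFE-Matching can be solved in $\mathrm{FPT}(n)$, where $n$ is the number of courses, when every course has a constant number of distinct positive valuations and constant capacity, for each course no two TAs have the same grade in it, and each TA has distinct valuations for its positively valued courses. That is, for all fixed constants $r,C$ there are a computable function $f$ and an algorithm that, given an instance $I$ with $n$ courses such that (i) each course $x_i$ has at most $r$ distinct positive values $v_i(t)$, $t\in T$, and capacity $c_i\le C$, (ii) $g_t(x)\ne g_{t'}(x)$ for all courses $x$ and distinct TAs $t,t'$, and (iii) $u_t(x)\ne u_t(y)$ for every TA $t$ and distinct courses $x,y$ with $u_t(x),u_t(y)>0$, runs in time $f(n)\cdot|I|^{O(1)}$ and outputs a MEFE matching if one exists and correctly reports that none exists otherwise.
   Context: An instance of MEFE-Matching consists of: a finite set of courses $X=\{x_1,\dots,x_n\}$; a finite set of TAs $T=\{t_1,\dots,t_m\}$; for each TA $t_i$ a utility (valuation) function $u_i=u_{t_i}\colon X\to\mathbb{Z}_{\ge 0}$ and a grade function $g_i=g_{t_i}\colon X\to\mathbb{Q}_{\ge 0}$; for each course $x_i$ a capacity $c_i$ (a positive integer) and a utility (valuation) function $v_i=v_{x_i}\colon T\to\mathbb{Z}_{\ge 0}$, where for every TA $t$ and course $x_i$ one has $v_i(t)=0$ if $u_t(x_i)=0$ and $v_i(t)>0$ otherwise; and a number $k\in\mathbb{Q}_{\ge 0}$. All numbers are encoded in binary; $|I|$ denotes the encoding length of the instance $I$. A matching is a function $\mu\colon T\to X\cup\{\emptyset\}$, where $\mu(t)=\emptyset$ means $t$ is unassigned; by convention $u_t(\emptyset)=0$.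 It is feasible if $|\mu^{-1}(x_i)|=c_i$ for every course $x_i$ and no TA $t$ is assigned to a course $x$ with $u_t(x)=0$. A MEFE (merit-based envy-free egalitarian) matching is a feasible matching $\mu$ such that (1) (satisfaction of courses) for every course $x_i$, $\mathrm{AvgUtil}(x_i)=\frac{1}{c_i}\sum_{t\in\mu^{-1}(x_i)}v_i(t)\ge k$; and (2) (merit-based envy-freeness) there are no two TAs $t_i,t_j$ with $\mu(t_j)\in X$, $g_i(\mu(t_j))\ge g_j(\mu(t_j))$ and $u_i(\mu(t_j))>u_i(\mu(t_i))$. *)

(* Defs.v *)
From Corelib Require Import BinNums.
From mathcomp Require Import all_boot all_order all_algebra.

Set Implicit Arguments.
Unset Strict Implicit.
Unset Printing Implicit Defensive.

Import Order.TTheory GRing.Theory Num.Theory.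

(** * Model of computation

    First-order Lisp over binary trees.  A program is a list of mutually
    recursive unary functions, and its running time is the number of nodes of
    its (call-by-value) evaluation derivation.  Every node is one elementary
    pointer operation: trees are never copied or compared, and the only test is
    whether a tree is [Leaf].  Keeping values as shared pointers, a Turing
    machine simulates [c] such steps in time polynomial in [c] and in the size
    of the input, and conversely, so that time bounds of the form
    [f(n) * |I|^O(1)] mean the same as for Turing machines. *)

Inductive tree := Leaf | Node of tree & tree.

(** Number of nodes; equivalently, the length of the bit string that writes the
    tree in preorder with one bit per node. *)
Fixpoint tree_size (a : tree) : nat :=
  if a is Node b c then (tree_size b + tree_size c).+1 else 1.

Definition hd (a : tree) : tree := if a is Node b _ then b else Leaf.
Definition tl (a : tree) : tree := if a is Node _ c then c else Leaf.

(** [EVar i] is a de Bruijn index, [ELet e1 e2] binds index 0 in [e2], and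
    [ECall j e] applies the [j]-th function of the program. *)
Inductive exp :=
| EVar of nat
| ELeaf
| ENode of exp & exp
| EHd of exp
| ETl of exp
| EIf of exp & exp & exp
| ELet of exp & exp
| ECall of nat & exp.

Definition program := seq exp.

(** [eval p env e a c]: in the environment [env], [e] evaluates to [a] in [c]
    steps.  Non-terminating expressions have no value. *)
Inductive eval (p : program) : seq tree -> exp -> tree -> nat -> Prop :=
| eval_Var env i : eval p env (EVar i) (nth Leaf env i) 1
| eval_Leaf env : eval p env ELeaf Leaf 1
| eval_Node env e1 e2 a1 a2 c1 c2 :
    eval p env e1 a1 c1 -> eval p env e2 a2 c2 ->
    eval p env (ENode e1 e2) (Node a1 a2) (c1 + c2).+1
| eval_Hd env e a c : eval p env e a c -> eval p env (EHd e) (hd a) c.+1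
| eval_Tl env e a c : eval p env e a c -> eval p env (ETl e) (tl a) c.+1
| eval_IfNode env e e1 e2 a1 a2 a c c1 :
    eval p env e (Node a1 a2) c -> eval p env e1 a c1 ->
    eval p env (EIf e e1 e2) a (c + c1).+1
| eval_IfLeaf env e e1 e2 a c c2 :
    eval p env e Leaf c -> eval p env e2 a c2 ->
    eval p env (EIf e e1 e2) a (c + c2).+1
| eval_Let env e1 e2 a1 a c1 c2 :
    eval p env e1 a1 c1 -> eval p (a1 :: env) e2 a c2 ->
    eval p env (ELet e1 e2) a (c1 + c2).+1
| eval_Call env j e a1 a c1 c2 :
    eval p env e a1 c1 -> eval p [:: a1] (nth ELeaf p j) a c2 ->
    eval p env (ECall j e) a (c1 + c2).+1.

(** The entry point is function 0. *)
Definition run (p : program) (a b : tree) (c : nat) : Prop :=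
  eval p [:: a] (nth ELeaf p 0) b c.

Lemma eval_det p env e a c a' c' :
  eval p env e a c -> eval p env e a' c' -> a = a' /\ c = c'.
Proof.
move=> H; elim: H a' c' => {env e a c} *.
all: match goal with H : eval _ _ _ _ _ |- _ => inversion H; subst; clear H end.
all: repeat match goal with
  | IH : forall a c, eval ?p ?env ?e a c -> _, H : eval ?p ?env ?e _ _ |- _ =>
      case: (IH _ _ H) => ? ?; subst; clear H
  end.
all: by [].
Qed.

(** * Encodings *)

(** Lists are right-nested and end in [Leaf]. *)
Definition enc_seq (s : seq tree) : tree := foldr Node Leaf s.

Definition enc_bool (b : bool) : tree := if b then Node Leaf Leaf else Leaf.

(** Binary notation, least significant bit first, without leading zeros;
    [0] is the empty list of bits. *)
Fixpoint bits_of_pos (q : positive) : seq bool :=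
  match q with
  | xH => [:: true]
  | xO q' => false :: bits_of_pos q'
  | xI q' => true :: bits_of_pos q'
  end.

Definition bits_of_nat (n : nat) : seq bool :=
  if bin_of_nat n is Npos q then bits_of_pos q else [::].

Definition enc_nat (n : nat) : tree := enc_seq [seq enc_bool b | b <- bits_of_nat n].

Definition enc_option (a : option tree) : tree :=
  if a is Some b then Node Leaf b else Leaf.

(** For nonnegative rationals only: the sign is dropped. *)
Definition enc_rat (q : rat) : tree :=
  Node (enc_nat `|numq q|) (enc_nat `|denq q|).

Definition computable (f : nat -> nat) : Prop :=
  exists p : program, forall n, exists c, run p (enc_nat n) (enc_nat (f n)) c.

(** * MEFE-Matching *)

(** [n] courses and [m] TAs. *)
Record instance (n m : nat) := Instance {
  ta_util : 'I_m -> 'I_n -> nat;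
  grade : 'I_m -> 'I_n -> rat;
  capacity : 'I_n -> nat;
  course_util : 'I_n -> 'I_m -> nat;
  threshold : rat;
  grade_ge0 : forall t x, (0 <= grade t x)%R;
  capacity_gt0 : forall x, 0 < capacity x;
  threshold_ge0 : (0 <= threshold)%R;
  course_utilP : forall t x,
    if ta_util t x == 0 then course_util x t = 0 else 0 < course_util x t
}.

Section Matching.

Variables (n m : nat) (I : instance n m).

Definition matching := {ffun 'I_m -> option 'I_n}.

Implicit Type mu : matching.

Definition assigned mu (x : 'I_n) : {set 'I_m} := [set t | mu t == Some x].

(** Utility of [t] for its own assignment; being unassigned is worth 0. *)
Definition own_util mu (t : 'I_m) : nat := oapp (ta_util I t) 0 (mu t).

Definition feasible mu : Prop :=
  (forall x, #|assigned mu x| = capacity I x) /\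
  (forall t x, mu t = Some x -> ta_util I t x <> 0).

Definition avg_util mu (x : 'I_n) : rat :=
  ((capacity I x)%:R^-1 * \sum_(t in assigned mu x) (course_util I x t)%:R)%R.

Definition courses_satisfied mu : Prop :=
  forall x, (threshold I <= avg_util mu x)%R.

Definition merit_envy_free mu : Prop :=
  ~ exists t t' x, [/\ t != t', mu t' = Some x,
      (grade I t' x <= grade I t x)%R & own_util mu t < ta_util I t x].

Definition MEFE mu : Prop :=
  [/\ feasible mu, courses_satisfied mu & merit_envy_free mu].

Definition positive_valuations (x : 'I_n) : seq nat :=
  undup [seq course_util I x t | t <- enum 'I_m & 0 < course_util I x t].

Definition distinct_grades : Prop :=
  forall x t t', t != t' -> grade I t x != grade I t' x.

Definition distinct_positive_utils : Prop :=
  forall t x y, x != y -> 0 < ta_util I t x -> 0 < ta_util I t y ->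
    ta_util I t x != ta_util I t y.

(** A course is its capacity with its valuations of all TAs, a TA is the list
    of its (utility, grade) pairs for all courses; [n] and [m] are the lengths
    of the two outer lists. *)
Definition enc_instance : tree :=
  enc_seq [::
    enc_seq [seq Node (enc_nat (capacity I x))
                      (enc_seq [seq enc_nat (course_util I x t) | t <- enum 'I_m])
            | x <- enum 'I_n];
    enc_seq [seq enc_seq [seq Node (enc_nat (ta_util I t x)) (enc_rat (grade I t x))
                         | x <- enum 'I_n]
            | t <- enum 'I_m];
    enc_rat (threshold I)].

Definition instance_size : nat := tree_size enc_instance.

Definition enc_matching mu : tree :=
  enc_seq [seq enc_option (omap (fun x : 'I_n => enc_nat x) (mu t)) | t <- enum 'I_m].

(** A MEFE matching, or [None] to report that there is none. *)
Definition correct_answer (o : option matching) : Prop :=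
  if o is Some mu then MEFE mu else forall mu, ~ MEFE mu.

Definition enc_answer (o : option matching) : tree :=
  enc_option (omap enc_matching o).

End Matching.

(* Main.v *)
Require Import Defs.
From Corelib Require Import BinNums PosDef.
From mathcomp Require Import all_boot all_order all_algebra zify.

Set Implicit Arguments.
Unset Strict Implicit.
Unset Printing Implicit Defensive.

Import Order.TTheory GRing.Theory Num.Theory.

(** If [mu t' = Some x] in a MEFE matching, every TA who is interested in [x]
    and whose grade there is at least that of [t'] is assigned.  Hence [t'] is a
    candidate for [x]: at most [n * C] interested TAs have such a grade.  Each
    course has at most [n * C] candidates, because the one of least grade counts
    all the others.  Since a product of factors [1 + a] is at most [2] to the
    sum of the [a], at most [2 ^ (n * (n * C))] assignments send every TA to a
    course it is a candidate for, and they can all be enumerated and tested.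

    For the running time, the enumeration is a polynomial-time function of the
    instance and of the number [2 ^ (n * (n * C))] written in unary.
    Polynomial-time functions are closed under composition and under folds
    whose intermediate values have polynomial size, so that programs never have
    to be written down except for these closure properties. *)

(** * Types with a tree encoding, and the sizes of encodings *)

Structure encType := EncType { enc_sort :> Type; enc : enc_sort -> tree }.
Arguments enc {e}.

Canonical unit_encType := @EncType unit (fun=> Leaf).
Canonical bool_encType := @EncType bool enc_bool.
Canonical prod_encType (A B : encType) :=
  @EncType (A * B) (fun z => Node (enc z.1) (enc z.2)).
Canonical seq_encType (A : encType) :=
  @EncType (seq A) (fun s => enc_seq [seq enc x | x <- s]).
Canonical option_encType (A : encType) :=
  @EncType (option A) (fun o => enc_option (omap enc o)).
(* Unary; binary numbers are of type [seq bool]. *)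
Canonical nat_encType := @EncType nat (fun n => enc (nseq n tt)).

Definition sz (A : encType) (a : A) := tree_size (enc a).

Lemma sz_gt0 (A : encType) (a : A) : 0 < sz a.
Proof. by rewrite /sz; case: (enc a). Qed.

Lemma sz_pair (A B : encType) (a : A) (b : B) :
  sz (a, b) = (sz a + sz b).+1.
Proof. by []. Qed.

Lemma sz_nil (A : encType) : sz ([::] : seq A) = 1.
Proof. by []. Qed.

Lemma sz_cons (A : encType) (x : A) s : sz (x :: s) = (sz x + sz s).+1.
Proof. by []. Qed.

Lemma sz_nat (n : nat) : sz n = n.*2.+1.
Proof.
elim: n => // n IH.
have -> : sz n.+1 = (1 + sz n).+1 by [].
by rewrite IH doubleS; lia.
Qed.

Lemma sz_bool (b : bool) : sz b <= 3.
Proof. by case: b. Qed.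

Lemma sz_cat (A : encType) (s t : seq A) : sz (s ++ t) = (sz s + sz t).-1.
Proof.
elim: s => [|x s IH]; first by rewrite sz_nil add1n.
rewrite cat_cons !sz_cons IH.
by have := sz_gt0 s; have := sz_gt0 t; lia.
Qed.

Lemma sz_rev (A : encType) (s : seq A) : sz (rev s) = sz s.
Proof.
elim: s => // x s IH; rewrite rev_cons -cats1 sz_cat IH !sz_cons.
by rewrite sz_nil; have := sz_gt0 s; lia.
Qed.

Lemma sz_drop (A : encType) (s : seq A) i : sz (drop i s) <= sz s.
Proof.
elim: s i => [|x s IH] [|i] //=; rewrite !sz_cons.
by have := IH i; lia.
Qed.

Lemma sz_take (A : encType) (s : seq A) i : sz (take i s) <= sz s.
Proof.
rewrite -{2}(cat_take_drop i s) sz_cat; have := sz_gt0 (drop i s).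
by have := sz_gt0 (take i s); lia.
Qed.

Lemma size_sz (A : encType) (s : seq A) : size s < sz s.
Proof. by elim: s => // x s IH; rewrite sz_cons /=; lia. Qed.

Lemma sz_seq_le (A : encType) K (s : seq A) :
  all (fun x => sz x <= K) s -> sz s <= (size s * K.+1).+1.
Proof. by elim: s => //= x s IH /andP[? /IH]; rewrite sz_cons; nia. Qed.

Lemma all_sz (A : encType) (s : seq A) : all (fun x => sz x <= sz s) s.
Proof.
elim: s => // x s IH; rewrite /= !sz_cons; apply/andP; split; first by lia.
by apply: sub_all IH => y; lia.
Qed.

(** * Computable functions with a time bound *)

(* Calls are absolute, so code is a function of the position at which it is
   loaded. *)
Definition loaded (b : program) (k : nat) (p : program) :=
  exists q1 q2, size q1 = k /\ p = q1 ++ b ++ q2.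

(** Quantifying over every program [p] that contains the block at position [k] makes the statement
    survive when the block becomes part of a larger program. *)
Definition cost_le (A B : encType) (f : A -> B)
    (T : A -> nat) :=
  exists b : nat -> program, forall k p, loaded (b k) k p -> forall a,
    exists2 c, eval p [:: enc a] (nth ELeaf p k) (enc (f a)) c & c <= T a.

Lemma loaded_cons e b k p :
  loaded (e :: b) k p -> nth ELeaf p k = e /\ loaded b k.+1 p.
Proof.
move=> [q1 [q2 [<- ->]]]; split; first by rewrite nth_cat ltnn subnn.
by exists (rcons q1 e), q2; rewrite size_rcons cat_rcons.
Qed.

Lemma loaded_cat b1 b2 k p :
  loaded (b1 ++ b2) k p -> loaded b1 k p /\ loaded b2 (k + size b1) p.
Proof.
move=> [q1 [q2 [<- ->]]]; split; first by exists q1, (b2 ++ q2); rewrite -!catA.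
by exists (q1 ++ b1), q2; rewrite size_cat -!catA.
Qed.

Section Cost.
Variables (A B : encType).

Lemma cost_leW (f : A -> B) T U :
  cost_le f T -> (forall a, T a <= U a) -> cost_le f U.
Proof.
move=> [b bP] TU; exists b => k p /bP{}bP a; have [c ? cT] := bP a.
by exists c => //; apply: leq_trans (TU a).
Qed.

Lemma cost_le_ext (f g : A -> B) T : f =1 g -> cost_le f T -> cost_le g T.
Proof.
by move=> fg [b bP]; exists b => k p /bP{}bP a; rewrite -fg; apply: bP.
Qed.

Lemma cost_le_run (f : A -> B) T : cost_le f T ->
  exists p, forall a, exists2 c, run p (enc a) (enc (f a)) c & c <= T a.
Proof.
move=> [b bP]; exists (b 0); apply: bP.
by exists [::], [::]; rewrite cats0.
Qed.

Lemma cost_prim (f : A -> B) e c :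
  (forall p a, exists2 c', eval p [:: enc a] e (enc (f a)) c' & c' <= c) ->
  cost_le f (fun=> c).
Proof.
by move=> eP; exists (fun=> [:: e]) => k p /loaded_cons[-> _] a; apply: eP.
Qed.

End Cost.

(** The entry function at [k] only calls the blocks of [f] and [g], which are laid out one after the
    other behind it. *)
Lemma cost_comp (A B D : encType)
    (f : A -> B) (g : B -> D) T U :
  cost_le f T -> cost_le g U ->
  cost_le (fun a => g (f a)) (fun a => (T a + U (f a)).+3).
Proof.
move=> [bf fP] [bg gP].
exists (fun k => let b := bf k.+1 in
  ECall (k.+1 + size b) (ECall k.+1 (EVar 0)) :: b ++ bg (k.+1 + size b)).
move=> k p /loaded_cons[-> /loaded_cat[/fP{}fP /gP{}gP]] a.
have [c cP cT] := fP a; have [c' cP' cT'] := gP (f a).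
exists ((1 + c).+1 + c').+1; last by lia.
exact: eval_Call (eval_Call (eval_Var p [:: enc a] 0) cP) cP'.
Qed.

Lemma cost_pair (A B D : encType)
    (f : A -> B) (g : A -> D) T U :
  cost_le f T -> cost_le g U ->
  cost_le (fun a => (f a, g a)) (fun a => (T a + U a).+1.+4).
Proof.
move=> [bf fP] [bg gP].
exists (fun k => let b := bf k.+1 in
  ENode (ECall k.+1 (EVar 0)) (ECall (k.+1 + size b) (EVar 0)) ::
  b ++ bg (k.+1 + size b)).
move=> k p /loaded_cons[-> /loaded_cat[/fP{}fP /gP{}gP]] a.
have [c cP cT] := fP a; have [c' cP' cT'] := gP a.
exists ((1 + c).+1 + (1 + c').+1).+1; last by lia.
exact: eval_Node (eval_Call (eval_Var p [:: enc a] 0) cP)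
                 (eval_Call (eval_Var p [:: enc a] 0) cP').
Qed.

(** The cost of the step is summed along the accumulators that really occur; 40 generously covers
    the overhead of one round of the loop. *)
Fixpoint foldl_cost A B X (g : A -> B -> X -> B) (T : A * (B * X) -> nat)
    (a : A) (b : B) (s : seq X) : nat :=
  if s is x :: s' then T (a, (b, x)) + foldl_cost g T a (g a b x) s' + 40
  else 40.

Lemma cost_foldl (A B X : encType)
    (g : A -> B -> X -> B) T :
  cost_le (fun z : A * (B * X) => g z.1 z.2.1 z.2.2) T ->
  cost_le (fun z : A * (B * seq X) => foldl (g z.1) z.2.1 z.2.2)
          (fun z => foldl_cost g T z.1 z.2.1 z.2.2).
Proof.
move=> [bg gP]; pose v := EVar 0.
(* The argument is the tree of [(a, (b, s))], so [ETl (ETl v)] is the rest of the list. The loop at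
   [k] calls itself with the updated accumulator, computed by the block at [k.+1]. *)
exists (fun k => EIf (ETl (ETl v))
  (ECall k (ENode (EHd v) (ENode (ECall k.+1 (ENode (EHd v) (ENode (EHd (ETl v))
     (EHd (ETl (ETl v)))))) (ETl (ETl (ETl v)))))) (EHd (ETl v)) :: bg k.+1).
move=> k p /loaded_cons[loop /gP{}gP] [a [b s]] /=; rewrite loop.
elim: s b => [|x s IH] b /=.
  eexists; first apply: eval_IfLeaf.
  - exact: (eval_Tl (eval_Tl (eval_Var p _ 0))).
  - exact: (eval_Hd (eval_Tl (eval_Var p _ 0))).
  - by [].
have [c /= cP cT] := gP (a, (b, x)); have [c' cP' cT'] := IH (g a b x).
have V z : eval p [:: z] v z 1 by exact: (eval_Var p [:: z] 0).
set z := Node _ _; set z' := Node (enc a) (Node (enc b) (enc x)).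
have Vg : eval p [:: z] (ENode (EHd v) (ENode (EHd (ETl v))
     (EHd (ETl (ETl v))))) z' (2 + (3 + 4).+1).+1.
  exact: eval_Node (eval_Hd (V z))
    (eval_Node (eval_Hd (eval_Tl (V z))) (eval_Hd (eval_Tl (eval_Tl (V z))))).
have Vt : eval p [:: z] (ETl (ETl (ETl v))) (enc_seq [seq enc y | y <- s]) 4.
  exact: eval_Tl (eval_Tl (eval_Tl (V z))).
eexists; first apply: eval_IfNode.
- exact: (eval_Tl (eval_Tl (V z))).
- apply: eval_Call; last by rewrite loop; exact: cP'.
  exact: eval_Node (eval_Hd (V z)) (eval_Node (eval_Call Vg cP) Vt).
- by lia.
Qed.

(** * Polynomial bounds *)

(** The base is at least 2, so constant factors and summands can be absorbed into the exponent. *)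
Definition pb (A : encType) (T : A -> nat) :=
  exists d, forall a, T a <= (sz a).+1 ^ d.

Section PolynomialBound.
Variables (A : encType).
Implicit Types T U : A -> nat.

Lemma pbW T U : pb U -> (forall a, T a <= U a) -> pb T.
Proof. by move=> [d dP] TU; exists d => a; apply: leq_trans (dP a). Qed.

Lemma leq_exp_sz d e (a : A) : d <= e -> (sz a).+1 ^ d <= (sz a).+1 ^ e.
Proof. by move=> de; rewrite leq_pexp2l. Qed.

Lemma pb_const k : pb (fun _ : A => k).
Proof.
exists k => a; apply: (@leq_trans (2 ^ k)); first exact/ltnW/ltn_expl.
by case: k => // k; rewrite leq_exp2r // ltnS sz_gt0.
Qed.

Lemma pb_sz : pb (fun a : A => sz a).
Proof. by exists 1 => a; rewrite expn1. Qed.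

Lemma pb_add T U : pb T -> pb U -> pb (fun a => T a + U a).
Proof.
move=> [d dP] [e eP]; exists (maxn d e).+1 => a; rewrite expnS.
have h1 := leq_exp_sz a (leq_maxl d e); have h2 := leq_exp_sz a (leq_maxr d e).
have := sz_gt0 a; have := dP a; have := eP a; nia.
Qed.

Lemma pb_mul T U : pb T -> pb U -> pb (fun a => T a * U a).
Proof.
by move=> [d dP] [e eP]; exists (d + e) => a; rewrite expnD leq_mul.
Qed.

Lemma pb_S T : pb T -> pb (fun a => (T a).+1).
Proof.
move=> Tp; apply: (pbW (pb_add (pb_const 1) Tp)) => a; exact: leqnn.
Qed.

Lemma pb_exp T d : pb T -> pb (fun a => T a ^ d).
Proof.
move=> Tp; elim: d => [|d IH]; first exact: pb_const.
by apply: pbW (pb_mul Tp IH) _ => a; rewrite expnS.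
Qed.

End PolynomialBound.

Lemma pb_comp (A B : encType) (f : A -> B) T :
  pb T -> pb (fun a => sz (f a)) -> pb (fun a => T (f a)).
Proof. by move=> [d dP] fp; apply: pbW (pb_exp d (pb_S fp)) _ => a. Qed.

(** This bounds one round of a loop in terms of the parameter [a] alone, uniformly in all
    accumulators of polynomial size. *)
Lemma pb_uniform (A B : encType) (T : A * B -> nat)
    (S : A -> nat) : pb T -> pb S ->
  exists2 U, pb U & forall a b, sz b <= S a -> T (a, b) <= U a.
Proof.
move=> [d dP] Sp; exists (fun a => (sz a + S a).+2 ^ d).
  by do ![apply: pb_exp | apply: pb_S | apply: pb_add | apply: pb_sz].
move=> a b bS; apply: leq_trans (dP _) _; case: d {dP} => // d.
by rewrite leq_exp2r // sz_pair; lia.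
Qed.

(** * Polynomial-time functions *)

(* Values are shared, so that the size of the result is not bounded in terms
   of the running time and has to be bounded separately. *)
Definition polytime (A B : encType) (f : A -> B) :=
  (exists2 T, cost_le f T & pb T) /\ pb (fun a => sz (f a)).

Section Polytime.
Variables (A : encType).

Lemma pt_ext (B : encType) (f g : A -> B) :
  f =1 g -> polytime f -> polytime g.
Proof.
move=> fg [[T fT Tp] fp]; split; first by exists T => //; apply: cost_le_ext fT.
by apply: pbW fp _ => a; rewrite fg.
Qed.

Lemma pt_comp (B D : encType) (f : A -> B) (g : B -> D) :
  polytime g -> polytime f -> polytime (fun a => g (f a)).
Proof.
move=> [[U gU Up] gp] [[T fT Tp] fp]; split; last exact: (pb_comp gp fp).
exists (fun a => (T a + U (f a)).+3); first exact: cost_comp.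
by do 3 apply: pb_S; apply: pb_add => //; apply: pb_comp.
Qed.

Lemma pt_pair (B D : encType) (f : A -> B) (g : A -> D) :
  polytime f -> polytime g -> polytime (fun a => (f a, g a)).
Proof.
move=> [[T fT Tp] fp] [[U gU Up] gp]; split.
  exists (fun a => (T a + U a).+1.+4); first exact: cost_pair.
  by do 5 apply: pb_S; apply: pb_add.
by apply: pb_S; apply: pb_add.
Qed.

Lemma pt_prim (B : encType) (f : A -> B) e c :
  (forall p a, exists2 c', eval p [:: enc a] e (enc (f a)) c' & c' <= c) ->
  pb (fun a => sz (f a)) -> polytime f.
Proof.
move=> /cost_prim fc fp; split=> //; exists (fun=> c) => //; exact: pb_const.
Qed.

Lemma pt_id : polytime (fun a : A => a).
Proof.
apply: (pt_prim (e := EVar 0) (c := 1)); last exact: pb_sz.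
by move=> p a; exists 1 => //; exact: (eval_Var p [:: enc a] 0).
Qed.

Fixpoint quote (t : tree) : exp :=
  if t is Node t1 t2 then ENode (quote t1) (quote t2) else ELeaf.

Lemma eval_quote p env t : eval p env (quote t) t (tree_size t).
Proof. by elim: t => [|t1 IH1 t2 IH2]; constructor. Qed.

Lemma pt_const (B : encType) (b : B) : polytime (fun _ : A => b).
Proof.
apply: (pt_prim (e := quote (enc b)) (c := sz b)); last exact: pb_const.
by move=> p a; exists (sz b) => //; apply: eval_quote.
Qed.

End Polytime.

Section Projections.
Variables (A B D : encType).

Lemma pt_fst (f : A -> B * D) : polytime f -> polytime (fun a => (f a).1).
Proof.
apply: pt_comp; apply: (pt_prim (e := EHd (EVar 0)) (c := 2)) => [p z|].
  by exists 2 => //; apply: (eval_Hd (eval_Var p [:: enc z] 0)).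
by apply: pbW (@pb_sz (B * D)%type) _ => -[b d]; rewrite sz_pair /=; lia.
Qed.

Lemma pt_snd (f : A -> B * D) : polytime f -> polytime (fun a => (f a).2).
Proof.
apply: pt_comp; apply: (pt_prim (e := ETl (EVar 0)) (c := 2)) => [p z|].
  by exists 2 => //; apply: (eval_Tl (eval_Var p [:: enc z] 0)).
by apply: pbW (@pb_sz (B * D)%type) _ => -[b d]; rewrite sz_pair /=; lia.
Qed.

End Projections.

Section Combinators.
Variables (A : encType).

Lemma pt_app2 (B D E : encType)
    (op : B -> D -> E) (f : A -> B) (g : A -> D) :
  polytime (fun z : B * D => op z.1 z.2) ->
  polytime f -> polytime g -> polytime (fun a => op (f a) (g a)).
Proof. by move=> opP fP gP; apply: pt_comp opP (pt_pair fP gP). Qed.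

Lemma pt_app3 (B D E F : encType)
    (op : B -> D -> E -> F) (f : A -> B) (g : A -> D) (h : A -> E) :
  polytime (fun z : B * (D * E) => op z.1 z.2.1 z.2.2) ->
  polytime f -> polytime g -> polytime h ->
  polytime (fun a => op (f a) (g a) (h a)).
Proof.
by move=> opP fP gP hP; apply: pt_comp opP (pt_pair fP (pt_pair gP hP)).
Qed.

Lemma pt_cons (B : encType) (f : A -> B) (g : A -> seq B) :
  polytime f -> polytime g -> polytime (fun a => f a :: g a).
Proof. exact: pt_pair. Qed.

(** [Some b] and the pair [(tt, b)] are encoded by the same tree. *)
Lemma pt_Some (B : encType) (f : A -> B) :
  polytime f -> polytime (fun a => Some (f a)).
Proof. exact: (pt_pair (pt_const A tt)). Qed.

End Combinators.

Lemma pt_if (A B : encType) (b : A -> bool) (f g : A -> B) :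
  polytime b -> polytime f -> polytime g ->
  polytime (fun a => if b a then f a else g a).
Proof.
apply: (pt_app3 (op := fun (b : bool) (x y : B) => if b then x else y)).
pose v := EVar 0.
apply: (pt_prim (e := EIf (EHd v) (EHd (ETl v)) (ETl (ETl v))) (c := 10)).
  move=> p [b0 [x y]]; set z := enc _.
  have V : eval p [:: z] v z 1 by exact: (eval_Var p [:: z] 0).
  case: b0 @z V => z V; eexists.
  - exact: eval_IfNode (eval_Hd V) (eval_Hd (eval_Tl V)).
  - by [].
  - exact: eval_IfLeaf (eval_Hd V) (eval_Tl (eval_Tl V)).
  - by [].
apply: pbW (@pb_sz (bool * (B * B))%type) _ => -[b0 [x y]].
by rewrite !sz_pair /=; case: b0; lia.
Qed.

Lemma pt_case_seq (A B X : encType)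
    (s : A -> seq X) (f g : A -> B) :
  polytime s -> polytime f -> polytime g ->
  polytime (fun a => if nilp (s a) then f a else g a).
Proof.
apply: (pt_app3 (op := fun (s : seq X) (x y : B) => if nilp s then x else y)).
pose v := EVar 0.
apply: (pt_prim (e := EIf (EHd v) (ETl (ETl v)) (EHd (ETl v))) (c := 10)).
  move=> p [b0 [x y]]; set z := enc _.
  have V : eval p [:: z] v z 1 by exact: (eval_Var p [:: z] 0).
  case: b0 @z V => [|b0 b1] z V; eexists.
  - exact: eval_IfLeaf (eval_Hd V) (eval_Hd (eval_Tl V)).
  - by [].
  - exact: eval_IfNode (eval_Hd V) (eval_Tl (eval_Tl V)).
  - by [].
apply: pbW (@pb_sz (seq X * (B * B))%type) _ => -[b0 [x y]].
by rewrite !sz_pair /=; case: nilp; lia.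
Qed.

Section Fold.
Variables (A B X : encType).
Variables (g : A -> B -> X -> B) (b : A -> B) (s : A -> seq X).
Hypotheses (gP : polytime (fun z : A * (B * X) => g z.1 z.2.1 z.2.2))
  (bP : polytime b) (sP : polytime s).

(** The bound [U] on all intermediate accumulators cannot be derived from [gP]: a polynomial-time
    step such as doubling, when iterated, produces values of exponential size. *)
Lemma pt_foldl (U : A -> nat) : pb U ->
  (forall a i, sz (foldl (g a) (b a) (take i (s a))) <= U a) ->
  polytime (fun a => foldl (g a) (b a) (s a)).
Proof.
move=> Up sU; split; last first.
  by apply: pbW Up _ => a; rewrite -{1}(take_size (s a)).
have [[[T gT Tp] _] [[T1 bT1 T1p] bp] [[T2 sT2 T2p] sp]] := And3 gP bP sP.
have [V Vp VP] := pb_uniform Tp (pb_S (pb_add Up sp)).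
have [T0 T0c T0p] : exists2 T0, cost_le (fun a => (a, (b a, s a))) T0 & pb T0.
  by case: (pt_pair (pt_id A) (pt_pair bP sP)).
have := cost_comp T0c (cost_foldl gT) => /cost_leW c.
exists (fun a => (T0 a + (sz (s a) * (V a + 40) + 40)).+3); last first.
  do 3 apply: pb_S; apply: pb_add => //; apply: pb_add; last exact: pb_const.
  by apply: pb_mul => //; apply: pb_add => //; apply: pb_const.
apply: c => a /=; rewrite !ltnS leq_add2l.
(* Generalized to a suffix [s'] of the list and the accumulator [b'] reached there; each round then
   costs at most [V a + 40]. *)
suff IH s' b' : (forall i, sz (foldl (g a) b' (take i s')) <= U a) ->
    sz s' <= sz (s a) ->
    foldl_cost g T a b' s' <= size s' * (V a + 40) + 40.
  apply: leq_trans (IH _ _ (sU a) (leqnn _)) _.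
  by rewrite leq_add2r leq_mul2r (ltnW (size_sz _)) orbT.
elim: s' b' => [|x s' IH] b' //= s'U; rewrite sz_cons => xs.
have := IH (g a b' x) (fun i => s'U i.+1).
have := VP a (b', x); rewrite sz_pair; have := s'U 0; rewrite /=.
rewrite !ltnS mulSn => ? h1 h2.
by have := h1 ltac:(lia); have := h2 ltac:(lia); lia.
Qed.

End Fold.

(* Proof search for polynomial time, and functions on lists *)
Create HintDb pt discriminated.
#[global] Hint Constants Opaque : pt.
#[global] Hint Resolve pt_id pt_const | 0 : pt.
#[global] Hint Resolve pt_pair pt_fst pt_snd pt_cons pt_Some pt_if : pt.
#[global] Hint Resolve pb_const pb_sz pb_add pb_mul pb_S pb_exp : pt.

Ltac pt := auto 40 with pt nocore.

Section Lists.
Variables (A B X : encType).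
Implicit Types s : A -> seq X.

Lemma pt_rev s : polytime s -> polytime (fun a => rev (s a)).
Proof.
move=> sP; have E t u : foldl (fun (u : seq X) x => x :: u) u t = catrev t u.
  by elim: t u => //= x t IH u.
apply: (pt_ext (f := fun a => foldl (fun u x => x :: u) [::] (s a))) => [a|].
  exact: E.
apply: (pt_foldl (g := fun _ (u : seq X) x => x :: u)
  _ _ sP (U := fun a => sz (s a))) => [|||a i].
- by pt.
- by pt.
- by case: sP.
- by rewrite E -/(rev _) sz_rev sz_take.
Qed.

(** A right fold is a left fold over the reversed list. Its intermediate values are the right folds
    of the suffixes, hence [drop] in the size condition. *)
Lemma pt_foldr (g : A -> X -> B -> B) b s (U : A -> nat) :
  polytime (fun z : A * (X * B) => g z.1 z.2.1 z.2.2) ->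
  polytime b -> polytime s -> pb U ->
  (forall a i, sz (foldr (g a) (b a) (drop i (s a))) <= U a) ->
  polytime (fun a => foldr (g a) (b a) (s a)).
Proof.
move=> gP bP sP Up sU.
pose h a y x := g a x y.
apply: (pt_ext (f := fun a => foldl (h a) (b a) (rev (s a)))) => [a|].
  exact: foldl_rev.
apply: (pt_foldl _ bP (pt_rev sP) Up) => [|a i].
  apply: (pt_comp (f := fun z => (z.1, (z.2.2, z.2.1))) gP).
  by pt.
by rewrite take_rev foldl_rev; apply: sU.
Qed.

End Lists.

Lemma pt_sz (A B : encType) (f : A -> B) :
  polytime f -> pb (fun a => sz (f a)).
Proof. by case. Qed.

#[global] Hint Resolve pt_sz : pt.

Lemma pt_succ (A : encType) (f : A -> nat) :
  polytime f -> polytime (fun a => (f a).+1).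
Proof. exact: (pt_pair (pt_const A tt)). Qed.

#[global] Hint Resolve pt_succ : pt.

Section ListFunctions.
Variables (A X : encType).
Implicit Types (s : A -> seq X).

Lemma pb_size s : polytime s -> pb (fun a => size (s a)).
Proof. by move=> [_ sp]; apply: pbW sp _ => a; apply/ltnW/size_sz. Qed.

Lemma pt_map (Y : encType) (h : A -> X -> Y) s :
  polytime (fun z : A * X => h z.1 z.2) -> polytime s ->
  polytime (fun a => map (h a) (s a)).
Proof.
move=> hP sP; have [V Vp VP] := pb_uniform (pt_sz hP) (pt_sz sP).
pose U a := (size (s a) * (V a).+1).+1.
have Up : pb U by apply/pb_S/pb_mul; [apply: pb_size | pt].
apply: (pt_foldr (g := fun a x t => h a x :: t) _ _ sP Up) => [||a i].
- apply: pt_cons; last by pt.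
  by apply: (pt_comp (f := fun z : A * (X * seq Y) => (z.1, z.2.1)) hP); pt.
- by pt.
- rewrite -/(map _ _); apply: leq_trans (sz_seq_le (K := V a) _) _.
    rewrite all_map; apply: sub_all (_ : all (fun x => sz x <= sz (s a)) _).
      by move=> x; apply: VP.
    by have := all_sz (s a); rewrite -{2}(cat_take_drop i (s a)) all_cat; case/andP.
  by rewrite size_map size_drop ltnS leq_mul2r leq_subr orbT.
Qed.

Lemma sz_filter p (t : seq X) : sz (filter p t) <= sz t.
Proof. by elim: t => //= x t IH; case: (p x); rewrite !sz_cons; lia. Qed.

Lemma pt_filter (p : A -> X -> bool) s :
  polytime (fun z : A * X => p z.1 z.2) -> polytime s ->
  polytime (fun a => filter (p a) (s a)).
Proof.
move=> pP sP.
apply: (pt_foldr (g := fun a x t => if p a x then x :: t else t)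
  (b := fun=> [::]) _ _ sP (pt_sz sP)) => [||a i].
- have := pt_comp (f := fun z : A * (X * seq X) => (z.1, z.2.1)) pP.
  by move=> /(_ ltac:(pt)) pP'; pt.
- by pt.
- by apply: leq_trans (sz_drop (s a) i); apply: sz_filter.
Qed.

Lemma pt_all (p : A -> X -> bool) s :
  polytime (fun z : A * X => p z.1 z.2) -> polytime s ->
  polytime (fun a => all (p a) (s a)).
Proof.
move=> pP sP.
apply: (pt_foldr (g := fun a x c => if p a x then c else false)
  (b := fun=> true) _ _ sP (pb_const _ 3)) => [||a i].
- have := pt_comp (f := fun z : A * (X * bool) => (z.1, z.2.1)) pP.
  by move=> /(_ ltac:(pt)) pP'; pt.
- by pt.
- exact: sz_bool.
Qed.

Lemma pt_size s : polytime s -> polytime (fun a => size (s a)).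
Proof.
move=> sP.
have -> : (fun a => size (s a)) = (fun a => foldr (fun _ n => n.+1) 0 (s a)).
  by [].
apply: (pt_foldr (g := fun _ _ n => n.+1) (b := fun=> 0) _ _ sP
  (U := fun a => (size (s a) * 2).+1)) => [|||a i].
- by pt.
- by pt.
- by apply/pb_S/pb_mul; [apply: pb_size|pt].
- by rewrite -[foldr _ _ _]/(size (drop i (s a))) sz_nat size_drop; lia.
Qed.

Lemma pt_behead s : polytime s -> polytime (fun a => behead (s a)).
Proof.
apply: (pt_comp (g := behead)).
apply: (pt_prim (e := ETl (EVar 0)) (c := 2)) => [p z|].
  exists 2 => //; have := eval_Tl (eval_Var p [:: enc z] 0).
  by case: z.
by apply: pbW (@pb_sz (seq X)) _ => -[//|x t]; rewrite [sz (_ :: _)]sz_cons /=; lia.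
Qed.

Lemma pt_head x0 s : polytime s -> polytime (fun a => head x0 (s a)).
Proof.
apply: (pt_comp (g := head x0)).
pose v := EVar 0.
apply: (pt_prim (e := EIf v (EHd v) (quote (enc x0))) (c := 4 + sz x0)).
  move=> p [|x t]; eexists.
  - exact: eval_IfLeaf (eval_Var p [:: _] 0) (eval_quote _ _ _).
  - by rewrite -/(sz x0); lia.
  - exact: eval_IfNode (eval_Var p [:: _] 0) (eval_Hd (eval_Var p [:: _] 0)).
  - by lia.
apply: (pbW (pb_add (pb_sz _) (pb_const _ (sz x0)))) => -[|x t] /=.
  exact: leq_addl.
by rewrite sz_cons; lia.
Qed.

Lemma pt_ohead s : polytime s -> polytime (fun a => ohead (s a)).
Proof.
apply: (pt_comp (g := @ohead X)).
pose v := EVar 0.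
apply: (pt_prim (e := EIf v (ENode ELeaf (EHd v)) ELeaf) (c := 10)).
  move=> p [|x t]; eexists.
  - exact: eval_IfLeaf (eval_Var p [:: _] 0) (eval_Leaf _ _).
  - by [].
  - exact: eval_IfNode (eval_Var p [:: _] 0)
      (eval_Node (eval_Leaf _ _) (eval_Hd (eval_Var p [:: _] 0))).
  - by [].
apply: (pbW (pb_S (pb_sz _))) => -[//|x t].
have -> : sz (ohead (x :: t)) = (1 + sz x).+1 by [].
by rewrite sz_cons; lia.
Qed.

End ListFunctions.

#[global] Hint Resolve pt_rev pt_map pt_filter pt_all pt_size pt_behead pt_head
  pt_ohead pb_size : pt.

(** Only encodings matter, so the result may be read in another type with the same trees. *)
Lemma pt_eq_enc (A B D : encType) (f : A -> B) (g : A -> D) :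
  (forall a, enc (f a) = enc (g a)) -> polytime f -> polytime g.
Proof.
move=> fg [[T [b bP] Tp] fp]; split; last first.
  by apply: pbW fp _ => a; rewrite /sz fg.
by exists T => //; exists b => k p /bP{}bP a; rewrite -fg; apply: bP.
Qed.

Section Append.
Variables (A X : encType).

Lemma pt_cat (s t : A -> seq X) :
  polytime s -> polytime t -> polytime (fun a => s a ++ t a).
Proof.
move=> sP tP; apply: (pt_ext (f := fun a => foldr cons (t a) (s a))) => [a|].
  by elim: (s a) => //= x u ->.
apply: (pt_foldr (g := fun _ => cons) _ tP sP
  (pb_add (pt_sz sP) (pt_sz tP))) => [|a i]; first by pt.
have -> : foldr cons (t a) (drop i (s a)) = drop i (s a) ++ t a.
  by elim: (drop _ _) => //= x u ->.
by rewrite sz_cat; have := sz_drop (s a) i; lia.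
Qed.

Lemma sz_flatten (s : seq (seq X)) : sz (flatten s) <= sz s.
Proof. by elim: s => //= t s IH; rewrite sz_cat sz_cons; lia. Qed.

End Append.

#[global] Hint Resolve pt_cat : pt.

Lemma pt_flatten (A X : encType) (s : A -> seq (seq X)) :
  polytime s -> polytime (fun a => flatten (s a)).
Proof.
move=> sP; apply: (pt_foldr (g := fun _ => cat) (b := fun=> [::]) _ _ sP
  (pt_sz sP)) => [||a i]; [by pt | by pt |].
by apply: leq_trans (sz_drop (s a) i); apply: sz_flatten.
Qed.

#[global] Hint Resolve pt_flatten : pt.

Section Booleans.
Variables (A : encType) (b c : A -> bool).
Hypotheses (bP : polytime b) (cP : polytime c).

Lemma pt_andb : polytime (fun a => b a && c a).
Proof. exact: (pt_if bP cP (pt_const A false)). Qed.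

Lemma pt_orb : polytime (fun a => b a || c a).
Proof. exact: (pt_if bP (pt_const A true) cP). Qed.

Lemma pt_negb : polytime (fun a => ~~ b a).
Proof. exact: (pt_if bP (pt_const A false) (pt_const A true)). Qed.

End Booleans.

#[global] Hint Resolve pt_andb pt_orb pt_negb : pt.

Lemma pt_addb (A : encType) (b c : A -> bool) :
  polytime b -> polytime c -> polytime (fun a => b a (+) c a).
Proof.
move=> bP cP; apply: pt_ext (pt_if bP (pt_negb cP) cP) => a.
by case: (b a).
Qed.

#[global] Hint Resolve pt_addb : pt.

(** * Iteration and arithmetic on unary numbers *)

Section Naturals.
Variables (A : encType).
Implicit Types f g : A -> nat.

(** A unary number is by definition encoded as a list of units, so nothing has to be computed. *)
Lemma pt_nseq_unit f : polytime f -> polytime (fun a => nseq (f a) tt).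
Proof. exact: id. Qed.

Lemma pt_pred f : polytime f -> polytime (fun a => (f a).-1).
Proof.
move=> /pt_nseq_unit/pt_behead; apply: pt_eq_enc => a.
by case: (f a).
Qed.

Lemma pb_nat f : polytime f -> pb f.
Proof. by move=> [_ fp]; apply: pbW fp _ => a; rewrite sz_nat; lia. Qed.

(** Since the number of rounds is unary, iteration is a fold over a list of units. *)
Lemma pt_iter (B : encType) (g : A -> B -> B) b f (U : A -> nat) :
  polytime (fun z : A * B => g z.1 z.2) -> polytime b -> polytime f -> pb U ->
  (forall a i, i <= f a -> sz (iter i (g a) (b a)) <= U a) ->
  polytime (fun a => iter (f a) (g a) (b a)).
Proof.
move=> gP bP fP Up fU; pose h a (x : B) (_ : unit) := g a x.
have E a i x : foldl (h a) x (nseq i tt) = iter i (g a) x.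
  by elim: i x => //= i IH x; rewrite IH -iterS iterSr.
apply: (pt_ext (f := fun a => foldl (h a) (b a) (nseq (f a) tt))) => [a|].
  exact: E.
apply: (pt_foldl _ bP (pt_nseq_unit fP) Up) => [|a i].
  by apply: (pt_comp (f := fun z : A * (B * unit) => (z.1, z.2.1)) gP); pt.
have [ltif|] := ltnP i (f a); last first.
  by move=> fi; rewrite take_oversize ?size_nseq // E fU.
by rewrite take_nseq ?E ?fU // ltnW.
Qed.

End Naturals.

#[global] Hint Resolve pt_pred pt_nseq_unit pb_nat : pt.

Section Arithmetic.
Variables (A : encType).
Implicit Types f g : A -> nat.

Lemma pt_addn f g : polytime f -> polytime g -> polytime (fun a => f a + g a).
Proof.
move=> fP gP; apply: (pt_ext (f := fun a => iter (f a) succn (g a))) => [a|].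
  by rewrite iter_succn addnC.
apply: (pt_iter (g := fun=> succn) _ gP fP (U := fun a => ((g a + f a) * 2).+1)).
- by pt.
- by pt.
- by move=> a i ?; rewrite iter_succn sz_nat; lia.
Qed.

Lemma pt_subn f g : polytime f -> polytime g -> polytime (fun a => f a - g a).
Proof.
move=> fP gP; apply: (pt_ext (f := fun a => iter (g a) predn (f a))) => [a|].
  exact: iter_predn.
apply: (pt_iter (g := fun=> predn) _ fP gP (U := fun a => (f a * 2).+1)).
- by pt.
- by pt.
- by move=> a i ?; rewrite iter_predn sz_nat; lia.
Qed.

Lemma pt_leq f g : polytime f -> polytime g -> polytime (fun a => f a <= g a).
Proof.
move=> fP gP.
apply: (pt_ext (f := fun a => if nilp (nseq (f a - g a) tt) then true else false)).
  by move=> a; rewrite /nilp size_nseq -[_ - _ == 0]/(f a <= g a); case: leq.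
by apply: pt_case_seq; [apply/pt_nseq_unit/pt_subn | pt | pt].
Qed.

Lemma pt_eqn f g : polytime f -> polytime g -> polytime (fun a => f a == g a).
Proof.
move=> fP gP; apply: (pt_ext (f := fun a => (f a <= g a) && (g a <= f a))).
  by move=> a; rewrite eqn_leq.
by apply: pt_andb; apply: pt_leq.
Qed.

Lemma pt_iota f : polytime f -> polytime (fun a => iota 0 (f a)).
Proof.
(* The length of the list built so far is the next number, so iterating [g] yields the range in
   reverse. *)
move=> fP; pose g (s : seq nat) := size s :: s.
have E i : iter i g [::] = rev (iota 0 i).
  elim: i => // i IH; rewrite iterS IH /g size_rev size_iota.
  by rewrite -addn1 iotaD rev_cat add0n.
apply: (pt_ext (f := fun a => rev (iter (f a) g [::]))) => [a|].
  by rewrite E revK.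
apply/pt_rev/(pt_iter (g := fun=> g) _ (pt_const A [::]) fP
  (U := fun a => (f a * (f a * 2).+2).+1)).
- by rewrite /g; pt.
- by pt.
- move=> a i fi; rewrite E sz_rev.
  apply: leq_trans (sz_seq_le (K := (f a * 2).+1) _) _.
    by apply/allP => j; rewrite mem_iota sz_nat; lia.
  by rewrite size_iota; nia.
Qed.

End Arithmetic.

#[global] Hint Resolve pt_addn pt_subn pt_leq pt_eqn pt_iota : pt.

Lemma pt_muln (A : encType) (f g : A -> nat) :
  polytime f -> polytime g -> polytime (fun a => f a * g a).
Proof.
move=> fP gP; apply: (pt_ext (f := fun a => iter (g a) (addn (f a)) 0)) => [a|].
  by rewrite iter_addn_0.
apply: (pt_iter (g := fun a => addn (f a)) _ (pt_const A 0) gP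
  (U := fun a => (f a * g a * 2).+1)).
- by apply: pt_addn; [apply: (pt_comp fP)|]; pt.
- by pt.
- by move=> a i ?; rewrite iter_addn_0 sz_nat; nia.
Qed.

Lemma pt_nth (A X : encType) (x0 : X) (s : A -> seq X) (i : A -> nat) :
  polytime s -> polytime i -> polytime (fun a => nth x0 (s a) (i a)).
Proof.
move=> sP iP.
have E (t : seq X) j : iter j behead t = drop j t.
  by elim: j t => [|j IH] [|x t] //; rewrite iterSr /= IH.
apply: (pt_ext (f := fun a => head x0 (iter (i a) behead (s a)))) => [a|].
  by rewrite E -nth0 nth_drop addn0.
apply/pt_head/(pt_iter (g := fun=> behead) _ sP iP (pt_sz sP)); first by pt.
by move=> a j _; rewrite E sz_drop.
Qed.

#[global] Hint Resolve pt_muln pt_nth : pt.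

(** * Binary arithmetic *)

Definition binval (s : seq bool) : nat :=
  foldr (fun (b : bool) n => b + n.*2) 0 s.

Lemma sz_bits (s : seq bool) : sz s <= (size s * 4).+1.
Proof. by apply: sz_seq_le; apply/allP => b _; apply: sz_bool. Qed.

(** The pair carries a suffix along with its successor: after a zero bit there is no carry, and the
    suffix itself is needed. *)
Definition binsucc_step (b : bool) (p : seq bool * seq bool) :=
  (b :: p.1, if b then false :: p.2 else true :: p.1).

Definition binsucc (s : seq bool) : seq bool :=
  (foldr binsucc_step ([::], [:: true]) s).2.

Lemma binsuccE b s :
  binsucc (b :: s) = if b then false :: binsucc s else true :: s.
Proof.
rewrite /binsucc /=.
suff -> : (foldr binsucc_step ([::], [:: true]) s).1 = s by [].
by elim: s => //= c s ->.
Qed.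

Lemma size_binsucc s : size (binsucc s) <= (size s).+1.
Proof. by elim: s => // -[] s IH; rewrite binsuccE //= ltnS. Qed.

(** Every [n] is the value of an element of [N], which reduces the claim to an induction on
    [positive], where [binsucc] follows the carries. The conversion from unary to binary is thereby
    an iteration of [binsucc]. *)
Lemma bits_of_natS n : bits_of_nat n.+1 = binsucc (bits_of_nat n).
Proof.
have bits_bin (q : N) :
    bits_of_nat (nat_of_bin q) = if q is Npos p then bits_of_pos p else [::].
  by rewrite /bits_of_nat nat_of_binK.
rewrite -(bin_of_natK n) bits_bin; case: (bin_of_nat n) => [|p] //=.
rewrite -nat_of_succ_pos (bits_bin (Npos _)).
by elim: p => //= p IH; rewrite binsuccE ?IH.
Qed.

Lemma iter_binsucc n : iter n binsucc [::] = bits_of_nat n.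
Proof. by elim: n => //= n ->; rewrite bits_of_natS. Qed.

Lemma binval_succ s : binval (binsucc s) = (binval s).+1.
Proof.
by elim: s => // -[] s IH; rewrite binsuccE /= ?IH // -/(binval _); lia.
Qed.

Lemma bits_of_natK : cancel bits_of_nat binval.
Proof. by elim=> // n IH; rewrite bits_of_natS binval_succ IH. Qed.

Lemma size_bits_of_nat n : size (bits_of_nat n) <= n.
Proof.
elim: n => // n IH; rewrite bits_of_natS.
by apply: leq_trans (size_binsucc _) _.
Qed.

Lemma pt_binsucc (A : encType) (s : A -> seq bool) :
  polytime s -> polytime (fun a => binsucc (s a)).
Proof.
move=> sP; rewrite /binsucc; apply: pt_snd.
apply: (pt_foldr (g := fun=> binsucc_step) (b := fun=> ([::], [:: true])) _ _ sP
  (U := fun a => ((size (s a) * 4).+1 + ((size (s a)).+1 * 4).+1).+1)).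
- by rewrite /binsucc_step; pt.
- by pt.
- by pt.
- move=> a i; set t := drop i (s a).
  have -> : foldr binsucc_step ([::], [:: true]) t = (t, binsucc t).
    by rewrite [LHS]surjective_pairing; congr pair; elim: t => //= c t ->.
  have ts : size t <= size (s a) by rewrite size_drop leq_subr.
  rewrite sz_pair; have := sz_bits t; have := sz_bits (binsucc t).
  by have := size_binsucc t; lia.
Qed.

#[global] Hint Resolve pt_binsucc : pt.

Lemma pt_bits_of_nat (A : encType) (f : A -> nat) :
  polytime f -> polytime (fun a => bits_of_nat (f a)).
Proof.
move=> fP; apply: (pt_ext (f := fun a => iter (f a) binsucc [::])) => [a|].
  exact: iter_binsucc.
apply: (pt_iter (g := fun=> binsucc) _ (pt_const A [::]) fP
  (U := fun a => (f a * 4).+1)); [by pt | by pt |] => a i fi.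
rewrite iter_binsucc; have := sz_bits (bits_of_nat i).
by have := size_bits_of_nat i; lia.
Qed.

#[global] Hint Resolve pt_bits_of_nat : pt.

(* Lists are padded with zeros to a common length that makes room for any
   carry. *)
Definition binzip (s t : seq bool) : seq (bool * bool) :=
  [seq (nth false s i, nth false t i) | i <- iota 0 (size s + size t)].

Lemma binval_pad s k : binval [seq nth false s i | i <- iota 0 (size s + k)] =
  binval s.
Proof.
rewrite iotaD map_cat map_nth_iota0 // take_size.
have -> : [seq nth false s i | i <- iota (0 + size s) k] = nseq k false.
  apply: (@eq_from_nth _ false) => [|i]; rewrite size_map size_iota ?size_nseq //.
  move=> ik; rewrite (nth_map 0) ?size_iota // nth_iota // nth_nseq ik.
  by rewrite nth_default // leq_addr.
elim: s => [|b s IH] /=; first by elim: k => //= k ->.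
by rewrite -/(binval _) IH.
Qed.

Lemma binval_zip1 s t : binval [seq p.1 | p <- binzip s t] = binval s.
Proof. by rewrite -map_comp binval_pad. Qed.

Lemma binval_zip2 s t : binval [seq p.2 | p <- binzip s t] = binval t.
Proof. by rewrite -map_comp addnC binval_pad. Qed.

Lemma pt_binzip (A : encType) (s t : A -> seq bool) :
  polytime s -> polytime t -> polytime (fun a => binzip (s a) (t a)).
Proof.
apply: (pt_app2 (op := binzip)); rewrite /binzip.
by apply: (pt_map (h := fun z i => (nth false z.1 i, nth false z.2 i))); pt.
Qed.

#[global] Hint Resolve pt_binzip : pt.

(** The state is the carry with the digits produced so far, most significant first. The new carry is
    the majority of the three bits. *)
Definition binadd_step (c : bool * seq bool) (p : bool * bool) :=
  (if c.1 then p.1 || p.2 else p.1 && p.2, c.1 (+) (p.1 (+) p.2) :: c.2).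

Definition binadd (s t : seq bool) : seq bool :=
  let c := foldl binadd_step (false, [::]) (binzip s t) in rev (c.1 :: c.2).

Lemma binval_rcons s b : binval (rcons s b) = binval s + b * 2 ^ size s.
Proof.
elim: s => [|c s IH] /=; first by rewrite muln1 addn0.
by rewrite -!/(binval _) IH expnS; nia.
Qed.

Lemma binaddE s t : binval (binadd s t) = binval s + binval t.
Proof.
rewrite /binadd; move: (binval_zip1 s t) (binval_zip2 s t).
move: (binzip s t) => u <- <-.
(* Loop invariant: the digits already produced, plus the carry and the remaining summands shifted by
   the number of these digits. *)
suff IH c : binval (let d := foldl binadd_step c u in rev (d.1 :: d.2)) =
    binval (rev c.2) + 2 ^ size c.2 *
    (c.1 + binval [seq p.1 | p <- u] + binval [seq p.2 | p <- u]).
  by rewrite IH mul1n.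
elim: u c => [|p u IH] c /=.
  by rewrite rev_cons binval_rcons size_rev; lia.
rewrite IH /= rev_cons binval_rcons size_rev expnS -!/(binval _).
move: (2 ^ _) (binval _) (binval _) (binval _) => w x y z.
by case: c => -[] ? /=; case: p => -[] [] /=; nia.
Qed.

Lemma size_foldl_binadd c u :
  size (foldl binadd_step c u).2 = size u + size c.2.
Proof. by elim: u c => //= p u IH c; rewrite IH /=; lia. Qed.

Lemma size_binadd s t : size (binadd s t) = (size s + size t).+1.
Proof.
by rewrite size_rev /= size_foldl_binadd size_map size_iota addn0.
Qed.

Lemma pt_binadd (A : encType) (s t : A -> seq bool) :
  polytime s -> polytime t -> polytime (fun a => binadd (s a) (t a)).
Proof.
move=> sP tP; rewrite /binadd.
have uP := pt_binzip sP tP.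
suff cP : polytime (fun a =>
    foldl binadd_step (false, [::]) (binzip (s a) (t a))) by pt.
apply: (pt_foldl (g := fun=> binadd_step) (b := fun=> (false, [::])) _ _ uP
  (U := fun a => (3 + (size (binzip (s a) (t a)) * 4).+1).+1)).
- by rewrite /binadd_step; pt.
- by pt.
- by pt.
- move=> a i; set u := take i _; rewrite [foldl _ _ _]surjective_pairing.
  rewrite sz_pair; have := sz_bool (foldl binadd_step (false, [::]) u).1.
  have := sz_bits (foldl binadd_step (false, [::]) u).2.
  by rewrite size_foldl_binadd size_take /= ; case: ltnP; lia.
Qed.

#[global] Hint Resolve pt_binadd : pt.

Definition binsum (u : seq (seq bool)) : seq bool := foldr binadd [::] u.

Lemma binsumE u : binval (binsum u) = sumn (map binval u).
Proof. by elim: u => //= s u IH; rewrite binaddE IH. Qed.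

Lemma pt_binsum (A : encType) (u : A -> seq (seq bool)) :
  polytime u -> polytime (fun a => binsum (u a)).
Proof.
move=> uP; apply: (pt_foldr (g := fun=> binadd) (b := fun=> [::]) _ _ uP
  (U := fun a => (sz (u a) * 4).+1)); [by pt | by pt | by pt |] => a i.
rewrite -/(binsum _); apply: leq_trans (sz_bits _) _.
rewrite ltnS leq_mul2r; apply: leq_trans (sz_drop _ i).
elim: (drop i (u a)) => //= s v IH; rewrite size_binadd sz_cons.
by rewrite ltnS leq_add // ltnW // (size_sz s).
Qed.

Definition binmul (s t : seq bool) : seq bool :=
  foldr (fun (b : bool) r => if b then binadd t (false :: r) else false :: r)
    [::] s.

Lemma binmulE s t : binval (binmul s t) = binval s * binval t.
Proof.
by elim: s => //= b s IH; case: b; rewrite ?binaddE /= -/(binval _) IH; lia.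
Qed.

Lemma size_binmul s t : size (binmul s t) <= size s * (size t).+2.
Proof. by elim: s => //= -[] s IH; rewrite ?size_binadd /=; lia. Qed.

Lemma pt_binmul (A : encType) (s t : A -> seq bool) :
  polytime s -> polytime t -> polytime (fun a => binmul (s a) (t a)).
Proof.
move=> sP tP.
apply: (pt_foldr
  (g := fun a (b : bool) r => if b then binadd (t a) (false :: r) else false :: r)
  (b := fun=> [::]) _ _ sP
  (U := fun a => (size (s a) * (size (t a)).+2 * 4).+1)).
- by have := pt_comp (f := fun z : A * (bool * seq bool) => z.1) tP; pt.
- by pt.
- by pt.
- move=> a i; rewrite -/(binmul _ _); apply: leq_trans (sz_bits _) _.
  rewrite ltnS leq_mul2r; apply: leq_trans (size_binmul _ _) _.
  by rewrite size_drop leq_mul2r leq_subr orbT.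
Qed.

(** The scan starts at the least significant bit, so the last differing position decides; the
    initial [true] stands for equality. *)
Definition binle (s t : seq bool) : bool :=
  foldl (fun r p => if p.1 (+) p.2 then p.2 else r) true (binzip s t).

Lemma binleE s t : binle s t = (binval s <= binval t).
Proof.
rewrite /binle -(binval_zip1 s t) -(binval_zip2 s t).
move: (binzip s t) => u.
suff -> r : foldl (fun r p => if p.1 (+) p.2 then p.2 else r) r u =
    let x := binval [seq p.1 | p <- u] in let y := binval [seq p.2 | p <- u] in
    if x == y then r else x <= y.
  by rewrite /= leq_eqVlt; case: eqP => // /eqP xy; rewrite leq_eqVlt (negPf xy).
elim: u r => //= p u IH r; rewrite IH -!/(binval _).
move: (binval _) (binval _) => x y.
by case: p => -[] [] /=; do ![case: eqP => /=]; lia.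
Qed.

Lemma pt_binle (A : encType) (s t : A -> seq bool) :
  polytime s -> polytime t -> polytime (fun a => binle (s a) (t a)).
Proof.
move=> sP tP.
apply: (pt_foldl (g := fun _ r p => if p.1 (+) p.2 then p.2 else r)
  (b := fun=> true) _ _ (pt_binzip sP tP) (pb_const _ 3)); [by pt | by pt |].
by move=> a i; apply: sz_bool.
Qed.

#[global] Hint Resolve pt_binsum pt_binmul pt_binle : pt.

(** * The algorithm *)

(** The final [unit] supplies the [Leaf] that ends the outer list of [enc_instance], so that nested
    pairs have the same tree as that list. *)
Notation input := ((seq (seq bool * seq (seq bool))) *
  (seq (seq (seq bool * (seq bool * seq bool))) *
   ((seq bool * seq bool) * unit)))%type (only parsing).

Section Algorithm.
Variables (C : nat).
Implicit Types (J : input) (t x N : nat) (mu : seq nat).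

Definition courses J := iota 0 (size J.1).
Definition tas J := iota 0 (size J.2.1).
Definition cap J x := (nth ([::], [::]) J.1 x).1.
Definition cutil J x t := nth [::] (nth ([::], [::]) J.1 x).2 t.
Definition util J t x := (nth ([::], ([::], [::])) (nth [::] J.2.1 t) x).1.
Definition gr J t x := (nth ([::], ([::], [::])) (nth [::] J.2.1 t) x).2.

Definition ratle (p q : seq bool * seq bool) :=
  binle (binmul p.1 q.2) (binmul q.1 p.2).

(** As [[::]] is the number 0, [~~ binle _ [::]] tests positivity. An interested [t] counts
    itself. *)
Definition better J t x :=
  [seq t' <- tas J | ~~ binle (util J t' x) [::] & ratle (gr J t x) (gr J t' x)].

Definition candidate J t x :=
  ~~ binle (util J t x) [::] && (size (better J t x) <= size J.1 * C).

(* In the internal representation of a matching as a list of numbers, 0 stands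
   for being unassigned and [x.+1] for the course [x]. *)
Definition options J t :=
  0 :: [seq x.+1 | x <- [seq x <- courses J | candidate J t x]].

Definition extend J N t (L : seq (seq nat)) :=
  let L' := flatten [seq [seq o :: mu | o <- options J t] | mu <- L] in
  if size L' <= N then L' else [::].

(* The bound [N] is never reached on the instances considered, but it makes
   the running time polynomial in [N] on all inputs. *)
Definition assignments J N := foldr (extend J N) [:: [::]] (tas J).

Definition holders J mu x := [seq t <- tas J | nth 0 mu t == x.+1].

Definition own J mu t :=
  if nth 0 mu t == 0 then [::] else util J t (nth 0 mu t).-1.

(** Equality with the capacity is tested by two inequalities between values. The condition on the
    average is multiplied by the capacity and by the denominator of the threshold. *)
Definition check_course J mu x :=
  [&& binle (bits_of_nat (size (holders J mu x))) (cap J x),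
      binle (cap J x) (bits_of_nat (size (holders J mu x))),
      binle (binmul J.2.2.1.1 (cap J x))
        (binmul J.2.2.1.2 (binsum [seq cutil J x t | t <- holders J mu x])) &
      all (fun t' => ~~ binle (util J t' x) [::] &&
        all (fun t => ~~ (ratle (gr J t' x) (gr J t x) &&
                          ~~ binle (util J t x) (own J mu t))) (tas J))
        (holders J mu x)].

Definition check J mu := all (check_course J mu) (courses J).

Definition decode mu :=
  [seq if v == 0 then None else Some (bits_of_nat v.-1) | v <- mu].

Definition solve (z : input * nat) :=
  ohead [seq decode mu | mu <- assignments z.1 z.2 & check z.1 mu].

(** * Polynomial running time of the algorithm *)

Section Accessors.
Variables (A : encType) (J : A -> input) (t x : A -> nat).
Hypotheses (JP : polytime J) (tP : polytime t) (xP : polytime x).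

Lemma pt_courses : polytime (fun a => courses (J a)).
Proof. by rewrite /courses; pt. Qed.

Lemma pt_tas : polytime (fun a => tas (J a)).
Proof. by rewrite /tas; pt. Qed.

Lemma pt_cap : polytime (fun a => cap (J a) (x a)).
Proof. by rewrite /cap; pt. Qed.

Lemma pt_cutil : polytime (fun a => cutil (J a) (x a) (t a)).
Proof. by rewrite /cutil; pt. Qed.

Lemma pt_util : polytime (fun a => util (J a) (t a) (x a)).
Proof. by rewrite /util; pt. Qed.

Lemma pt_gr : polytime (fun a => gr (J a) (t a) (x a)).
Proof. by rewrite /gr; pt. Qed.

Lemma pt_ratle (p q : A -> seq bool * seq bool) :
  polytime p -> polytime q -> polytime (fun a => ratle (p a) (q a)).
Proof. by rewrite /ratle; pt. Qed.

End Accessors.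

#[local] Hint Resolve pt_courses pt_tas pt_cap pt_cutil pt_util pt_gr pt_ratle
  : pt.

Section Lookups.
Variables (A : encType) (J : A -> input) (t x : A -> nat) (mu : A -> seq nat).
Hypotheses (JP : polytime J) (tP : polytime t) (xP : polytime x)
  (muP : polytime mu).

(** Passing to the triple of arguments turns [J], [t] and [x] into projections, which the proof
    search can handle under the binder of the filter. *)
Lemma pt_better : polytime (fun a => better (J a) (t a) (x a)).
Proof. by apply: (pt_app3 (op := better)) => //; rewrite /better; pt. Qed.

Lemma pt_holders : polytime (fun a => holders (J a) (mu a) (x a)).
Proof. by apply: (pt_app3 (op := holders)) => //; rewrite /holders; pt. Qed.

Lemma pt_own : polytime (fun a => own (J a) (mu a) (t a)).
Proof. by rewrite /own; pt. Qed.

End Lookups.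

#[local] Hint Resolve pt_better pt_holders pt_own : pt.

Section Checks.
Variables (A : encType) (J : A -> input) (t x : A -> nat) (mu : A -> seq nat).
Hypotheses (JP : polytime J) (tP : polytime t) (xP : polytime x)
  (muP : polytime mu).

Lemma pt_candidate : polytime (fun a => candidate (J a) (t a) (x a)).
Proof. by rewrite /candidate; pt. Qed.

Lemma pt_check_course : polytime (fun a => check_course (J a) (mu a) (x a)).
Proof.
by apply: (pt_app3 (op := check_course)) => //; rewrite /check_course; pt.
Qed.

End Checks.

#[local] Hint Resolve pt_candidate pt_check_course : pt.

Lemma pt_options (A : encType) (J : A -> input) (t : A -> nat) :
  polytime J -> polytime t -> polytime (fun a => options (J a) (t a)).
Proof. by apply: (pt_app2 (op := options)); rewrite /options; pt. Qed.

Lemma pt_check (A : encType) (J : A -> input) (mu : A -> seq nat) :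
  polytime J -> polytime mu -> polytime (fun a => check (J a) (mu a)).
Proof. by apply: (pt_app2 (op := check)); rewrite /check; pt. Qed.

#[local] Hint Resolve pt_options pt_check : pt.

Lemma options_le J t : all (fun o => o <= size J.1) (options J t).
Proof.
apply/allP => o; rewrite inE => /predU1P[->//|/mapP[x]].
by rewrite mem_filter mem_iota => /andP[_ /andP[_ ?]] ->.
Qed.

Lemma size_extend J N t L : size (extend J N t L) <= N.
Proof. by rewrite /extend; case: ifP. Qed.

Lemma mem_extend J N t L mu : mu \in extend J N t L ->
  exists o nu, [/\ o \in options J t, nu \in L & mu = o :: nu].
Proof.
rewrite /extend; case: ifP => // _ /flatten_mapP[nu nuL].
by move: (options J t) => s /mapP[o os ->]; exists o, nu.
Qed.

(** This serves twice: it bounds the size of the intermediate lists of the enumeration, and it later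
    shows that every enumerated list represents a matching. *)
Lemma mem_extend_foldr J N s mu :
  mu \in foldr (extend J N) [:: [::]] s ->
  (size mu == size s) && all (fun o => o <= size J.1) mu.
Proof.
elim: s mu => [|t s IH] mu; first by rewrite inE => /eqP->.
move=> /mem_extend[o [nu [oP /IH/andP[nus nuP] ->]]].
by rewrite /= eqSS nus nuP (allP (options_le J t)).
Qed.

Lemma pt_assignments (A : encType) (J : A -> input) (N : A -> nat) :
  polytime J -> polytime N -> polytime (fun a => assignments (J a) (N a)).
Proof.
apply: (pt_app2 (op := assignments)).
apply: (pt_foldr (g := fun z => extend z.1 z.2) (b := fun=> [:: [::]])
  (s := fun z => tas z.1)
  (U := fun z => (z.2.+1 * (size z.1.2.1 * (size z.1.1 * 2).+2).+2).+1)).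
- by rewrite /extend; pt.
- by pt.
- by pt.
- by pt.
- case=> J0 N0 i /=; set s := drop i _.
  have ss : size s <= size J0.2.1.
    by rewrite size_drop size_iota leq_subr.
  set L := foldr _ _ _.
  (* The start value [[:: [::]]] has one element and is not subject to the cap, hence the
     successor. *)
  have sL : size L <= N0.+1.
    by rewrite /L; case: s {ss L} => // t s; apply/leqW/size_extend.
  apply: leq_trans (sz_seq_le
    (K := (size J0.2.1 * (size J0.1 * 2).+2).+1) _) _.
    apply/allP => nu /mem_extend_foldr/andP[/eqP nus /allP nuP].
    apply: leq_trans (sz_seq_le (K := (size J0.1 * 2).+1) _) _.
      apply/allP => o /nuP oP; rewrite sz_nat ltnS -muln2.
      exact: leq_mul oP (leqnn 2).
    by rewrite nus ltnS leq_mul2r ss orbT.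
  by rewrite ltnS leq_mul2r sL orbT.
Qed.

#[local] Hint Resolve pt_assignments : pt.

Lemma pt_solve : polytime solve.
Proof.
rewrite /solve; apply/pt_ohead/pt_map; last by pt.
by apply: pt_map; [apply: pt_if|]; pt.
Qed.

End Algorithm.

(** * Fixed-parameter bounds *)

(** The parameter of [a] is [w a]. Its successor in the exponent lets [K] absorb constants even when
    the parameter is 0. *)
Definition fptb (A : encType) (w T : A -> nat) :=
  exists K d, forall a, T a <= 2 ^ (K * (w a).+1) * sz a ^ d.

Section FixedParameterBound.
Variables (A : encType) (w : A -> nat).
Implicit Types T U : A -> nat.

Lemma fptbW T U : fptb w U -> (forall a, T a <= U a) -> fptb w T.
Proof.
by move=> [K [d Kd]] TU; exists K, d => a; apply: leq_trans (Kd a).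
Qed.

Lemma fptb_mul T U : fptb w T -> fptb w U -> fptb w (fun a => T a * U a).
Proof.
move=> [K [d Kd]] [L [e Le]]; exists (K + L), (d + e) => a.
by rewrite mulnDl !expnD mulnACA leq_mul.
Qed.

Lemma fptb_exp2 u L : (forall a, u a <= L * (w a).+1) ->
  fptb w (fun a => 2 ^ u a).
Proof. by move=> uL; exists L, 0 => a; rewrite muln1 leq_pexp2l. Qed.

Lemma fptb_const k : fptb w (fun=> k).
Proof.
apply: (@fptbW _ (fun=> 2 ^ k)); last by move=> _; apply/ltnW/ltn_expl.
by apply: (@fptb_exp2 _ k) => a; rewrite leq_pmulr.
Qed.

Lemma fptb_add T U : fptb w T -> fptb w U -> fptb w (fun a => T a + U a).
Proof.
have gt0 K d a : 0 < 2 ^ (K * (w a).+1) * sz a ^ d.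
  by rewrite muln_gt0 !expn_gt0 sz_gt0.
move=> [K [d Kd]] [L [e Le]].
(* Positive integers satisfy [x + y <= 2 * (x * y)], so closure under products suffices. *)
have [M [f Mf]] := fptb_mul (fptb_const 2) (fptb_mul
  (ex_intro _ K (ex_intro _ d (fun=> leqnn _)))
  (ex_intro _ L (ex_intro _ e (fun=> leqnn _)))).
exists M, f => a; apply: leq_trans (Mf a).
by have := Kd a; have := Le a; have := gt0 K d a; have := gt0 L e a; nia.
Qed.

Lemma fptb_S T : fptb w T -> fptb w (fun a => (T a).+1).
Proof. exact: fptb_add (fptb_const 1). Qed.

Lemma fptb_exp T d : fptb w T -> fptb w (fun a => T a ^ d).
Proof.
move=> TP; elim: d => [|d IH]; first exact: fptb_const.
by apply: fptbW (fptb_mul TP IH) _ => a; rewrite expnS.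
Qed.

Lemma fptb_pb T : pb T -> fptb w T.
Proof.
move=> [d dP]; apply: fptbW (fptb_exp d (fptb_S _)) dP.
by exists 0, 1 => a; rewrite expn1 mul1n.
Qed.

End FixedParameterBound.

(** The unary result has exponential size, so this function is not [polytime], and the cost of
    repeated doubling is summed by hand. *)
Lemma cost_exp2 : exists2 T, cost_le (fun e : nat => 2 ^ e) T & fptb id T.
Proof.
pose g (_ : unit) (b : nat) (_ : unit) := b + b.
have [[T gT [d Td]] _] : polytime (fun z : unit * (nat * unit) =>
    g z.1 z.2.1 z.2.2) by rewrite /g; pt.
have [[T0 iT T0P] _] : polytime (fun e : nat => (tt, (1, nseq e tt))) by pt.
have c := cost_comp iT (cost_foldl gT).
exists (fun e => (T0 e + e.+1 * (2 ^ ((e + 3) * d) + 40)).+3); last first.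
  do 3 apply: fptb_S; apply: fptb_add; first exact: fptb_pb.
  apply: fptb_mul; first by apply: fptb_pb; pt.
  apply: fptb_add; last exact: fptb_const.
  by apply: (@fptb_exp2 _ _ _ (3 * d)) => e; nia.
apply: cost_le_ext (cost_leW c _) => [e|e] /=.
  suff E i : foldl (g tt) (2 ^ i) (nseq e tt) = 2 ^ (i + e) by exact: (E 0).
  elim: e i => [|e IH] i /=; first by rewrite addn0.
  by rewrite /g addnn -mul2n -expnS IH addSnnS.
(* The argument has size [2 * 2 ^ i + 5], and [2 * 2 ^ i + 6 <= 2 ^ (i + 3)]. *)
have {}Td i : T (tt, (2 ^ i, tt)) <= 2 ^ ((i + 3) * d).
  apply: leq_trans (Td _) _; rewrite expnM; case: (d) => // d'.
  rewrite leq_exp2r // expnD !sz_pair sz_nat.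
  by have := expn_gt0 2 i; rewrite (_ : sz tt = 1) // -muln2; lia.
rewrite !ltnS leq_add2l.
suff E i : foldl_cost g T tt (2 ^ i) (nseq e tt) <=
    e.+1 * (2 ^ ((i + e + 3) * d) + 40) by exact: (E 0).
elim: e i => [|e IH] i /=; first by lia.
have := IH i.+1; rewrite /g addnn -mul2n -expnS addSnnS.
have : 2 ^ ((i + 3) * d) <= 2 ^ ((i + e.+1 + 3) * d).
  by rewrite leq_pexp2l // leq_mul2r; lia.
by have := Td i; nia.
Qed.

(** The exponent is computed in polynomial time and the cap by [cost_exp2]. Then [solve] is
    polynomial in the input and the unary cap, which is at most exponential in the square of the
    number of courses; the factor [C] goes into [K]. *)
Lemma solve_fpt C : exists p K d, forall J : input, exists2 c,
  run p (enc J) (enc (solve C (J, 2 ^ (size J.1 * (size J.1 * C))))) c &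
  c <= 2 ^ (K * (size J.1 * size J.1).+1) * sz J ^ d.
Proof.
pose e (J : input) := size J.1 * (size J.1 * C).
pose w (J : input) := size J.1 * size J.1.
have [T eT TP] := cost_exp2.
have eP : polytime e by rewrite /e; pt.
have [[Te eTe TeP] esz] := eP.
have [[Ti iTi TiP] _] := @pt_id (input : encType).
have [[Ts sTs [d TsP]] _] := pt_solve C.
have c := cost_comp (cost_pair iTi (cost_comp eTe eT)) sTs.
have we J : e J <= C * (w J).+1 by rewrite /e /w; nia.
have expP : fptb w (fun J => 2 ^ e J) by apply: fptb_exp2 we.
have [p pP] := cost_le_run c.
suff [K [D KD]] : fptb w (fun J =>
    (((Ti J + (Te J + T (e J)).+3).+1.+4) + Ts (J, 2 ^ e J)).+3).
  exists p, K, D => J; have [n run_n nc] := pP J.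
  by exists n => //; apply: leq_trans (KD J).
do 3 apply: fptb_S; apply: fptb_add.
  do 5 apply: fptb_S; apply: fptb_add; first exact: fptb_pb.
  do 3 apply: fptb_S; apply: fptb_add; first exact: fptb_pb.
  have [K [D KD]] := TP; apply: fptbW (fptb_mul _ _) (fun J => KD (e J)).
    apply: (@fptb_exp2 _ _ _ (K * C.+1)) => J.
    by have := we J; rewrite -mulnA leq_mul2l; nia.
  by apply: fptb_exp; apply: fptb_pb.
apply: fptbW (fptb_exp d (T := fun J => (sz J + (2 ^ e J * 2).+1).+2) _) _.
  do 2 apply: fptb_S; apply: fptb_add; first exact/fptb_pb/pb_sz.
  by apply: fptb_S; apply: fptb_mul => //; apply: fptb_const.
by move=> J; have := TsP (J, 2 ^ e J); rewrite sz_pair sz_nat muln2.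
Qed.

(** * Computability of the parameter-dependent factor *)

Definition unary (s : seq bool) : nat :=
  foldl (fun n (b : bool) => n + n + (if b then 1 else 0)) 0 (rev s).

Lemma unaryE s : unary s = binval s.
Proof.
rewrite /unary foldl_rev; elim: s => //= b s ->.
by rewrite -/(binval s) addnn; case: b; lia.
Qed.

Lemma bits_of_nat_double n : 0 < n -> bits_of_nat n.*2 = false :: bits_of_nat n.
Proof.
rewrite /bits_of_nat -{1 2}(bin_of_natK n).
case: (bin_of_nat n) => //= p _.
have -> : (nat_of_pos p).*2 = nat_of_bin (Npos (xO p)) by rewrite /= natTrecE.
by rewrite nat_of_binK.
Qed.

Lemma bits_of_nat_exp2 k : bits_of_nat (2 ^ k) = iter k (cons false) [:: true].
Proof.
by elim: k => //= k <-; rewrite expnS mul2n bits_of_nat_double ?expn_gt0.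
Qed.

(** Input and output are binary: the input is converted to unary, and the power is written as a one
    behind the right number of zero bits. Only termination matters here, so the exponential cost of
    [unary] is harmless. *)
Lemma computable_exp2 K : computable (fun n => 2 ^ (K * (n * n).+1)).
Proof.
have [T uT] : exists T, cost_le unary T.
  have [[Ti iT _] _] :
      polytime (fun s : seq bool => (tt, (0, rev s))) by pt.
  have [[T gT _] _] : polytime (fun z : unit * (nat * bool) =>
      z.2.1 + z.2.1 + (if z.2.2 then 1 else 0)) by pt.
  pose g (_ : unit) n (b : bool) := n + n + (if b then 1 else 0).
  eexists; exact: cost_comp iT (cost_foldl (g := g) gT).
have [[U fU _] _] : polytime (fun n =>
    iter (K * (n * n).+1) (cons false) [:: true]).
  apply: (pt_iter (g := fun=> cons false) (b := fun=> [:: true])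
    (f := fun n => K * (n * n).+1) (U := fun n => (K * (n * n).+1 * 4 + 8)));
    [by pt | by pt | by pt | by pt |] => n i ni.
  apply: leq_trans (sz_bits _) _.
  have -> : size (iter i (cons false) [:: true]) = i.+1.
    by elim: (i) => //= j ->.
  by lia.
have [p pP] := cost_le_run (cost_comp uT fU).
exists p => n; have [c] := pP (bits_of_nat n).
by rewrite unaryE bits_of_natK -bits_of_nat_exp2; exists c.
Qed.

(** * Correctness *)

Lemma absz_numq (q : rat) : (0 <= q)%R -> Posz `|numq q| = numq q.
Proof. by move=> q0; rewrite gez0_abs ?numq_ge0. Qed.

Lemma absz_denq (q : rat) : Posz `|denq q| = denq q.
Proof. by rewrite gez0_abs ?denq_ge0. Qed.

Lemma leq_rat_numden (p q : rat) : (0 <= p)%R -> (0 <= q)%R ->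
  (p <= q)%R = (`|numq p| * `|denq q| <= `|numq q| * `|denq p|).
Proof.
move=> p0 q0; have -> : (p <= q)%R = le_rat p q by [].
by rewrite le_ratE -(absz_numq p0) -(absz_numq q0) -(absz_denq p) -(absz_denq q).
Qed.

Lemma rat_mul_leq_nat (q : rat) (a b : nat) : (0 <= q)%R ->
  (q * a%:R <= b%:R)%R = (`|numq q| * a <= `|denq q| * b).
Proof.
move=> q0; rewrite -{1}(divq_num_den q) mulrAC ler_pdivrMr ?ltr0z ?denq_gt0 //.
rewrite -(absz_numq q0) -absz_denq -!pmulrn -!natrM ler_nat.
by rewrite [b * _]mulnC.
Qed.

Lemma all_iota_ord n (p : pred nat) :
  all p (iota 0 n) = [forall i : 'I_n, p i].
Proof.
apply/allP/forallP => [pP i|pP i]; first by apply: pP; rewrite mem_iota /= ltn_ord.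
by rewrite mem_iota => /= ltin; apply: (pP (Ordinal ltin)).
Qed.

Lemma filter_iota_ord n (p : pred nat) :
  [seq i <- iota 0 n | p i] = [seq val i | i <- enum [set i : 'I_n | p i]].
Proof.
rewrite -val_enum_ord filter_map; congr map.
rewrite /enum_mem -filter_predI; apply: eq_filter => i /=.
by rewrite andbT inE.
Qed.

Section Correctness.
Variables (n m C : nat) (I : instance n m).
Hypothesis capC : forall x, capacity I x <= C.

Definition rat_input (q : rat) := (bits_of_nat `|numq q|, bits_of_nat `|denq q|).

Definition instance_input : input :=
  ([seq (bits_of_nat (capacity I x),
         [seq bits_of_nat (course_util I x t) | t <- enum 'I_m])
   | x <- enum 'I_n],
   ([seq [seq (bits_of_nat (ta_util I t x), rat_input (grade I t x))
         | x <- enum 'I_n]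
    | t <- enum 'I_m],
    (rat_input (threshold I), tt))).

Local Notation J := instance_input.

(** This transfers what is proved for the typed input to the encoding that the program receives. *)
Lemma enc_instance_input : enc J = enc_instance I.
Proof.
congr (Node _ (Node _ _)).
  rewrite /= -map_comp; congr enc_seq; apply: eq_map => x.
  by congr Node; rewrite /= -map_comp.
rewrite /= -map_comp; congr enc_seq; apply: eq_map => x.
by rewrite /= -map_comp.
Qed.

Lemma size_courses : size J.1 = n.
Proof. by rewrite size_map size_enum_ord. Qed.

Lemma size_tas : size J.2.1 = m.
Proof. by rewrite size_map size_enum_ord. Qed.

Lemma nth_map_ord k (T : Type) (y : T) (f : 'I_k -> T) (i : 'I_k) :
  nth y [seq f j | j <- enum 'I_k] i = f i.
Proof. by rewrite (nth_map i) ?size_enum_ord // nth_ord_enum. Qed.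

Lemma capE (x : 'I_n) : cap J x = bits_of_nat (capacity I x).
Proof. by rewrite /cap nth_map_ord. Qed.

Lemma cutilE (x : 'I_n) (t : 'I_m) :
  cutil J x t = bits_of_nat (course_util I x t).
Proof. by rewrite /cutil nth_map_ord /= nth_map_ord. Qed.

Lemma utilE (t : 'I_m) (x : 'I_n) : util J t x = bits_of_nat (ta_util I t x).
Proof. by rewrite /util nth_map_ord /= nth_map_ord. Qed.

Lemma grE (t : 'I_m) (x : 'I_n) : gr J t x = rat_input (grade I t x).
Proof. by rewrite /gr nth_map_ord /= nth_map_ord. Qed.

Lemma util_gt0E (t : 'I_m) (x : 'I_n) :
  ~~ binle (util J t x) [::] = (0 < ta_util I t x).
Proof. by rewrite binleE utilE bits_of_natK -ltnNge. Qed.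

Lemma ratle_grE (t t' : 'I_m) (x : 'I_n) :
  ratle (gr J t x) (gr J t' x) = (grade I t x <= grade I t' x)%R.
Proof.
rewrite /ratle !grE binleE !binmulE !bits_of_natK -leq_rat_numden //.
all: exact: grade_ge0.
Qed.

Lemma betterE (t : 'I_m) (x : 'I_n) :
  size (better J t x) =
  #|[set t' | (0 < ta_util I t' x) && (grade I t x <= grade I t' x)%R]|.
Proof.
rewrite /better /tas size_tas filter_iota_ord size_map -cardE.
by apply: eq_card => t'; rewrite !inE util_gt0E ratle_grE.
Qed.

Lemma candidateE (t : 'I_m) (x : 'I_n) : candidate C J t x =
  (0 < ta_util I t x) &&
  (#|[set t' | (0 < ta_util I t' x) && (grade I t x <= grade I t' x)%R]|
     <= n * C).
Proof. by rewrite /candidate util_gt0E betterE size_courses. Qed.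

(** * Matchings as lists of numbers, and correctness of the test *)

Definition matching_input (mu : matching n m) : seq nat :=
  [seq oapp (fun x : 'I_n => x.+1) 0 (mu t) | t <- enum 'I_m].

Lemma enc_decode mu : enc (decode (matching_input mu)) = enc_matching mu.
Proof.
rewrite /= -2!map_comp; congr enc_seq; apply: eq_map => t /=.
by case: (mu t).
Qed.

Lemma holdersE mu (x : 'I_n) :
  holders J (matching_input mu) x = [seq val t | t <- enum (assigned mu x)].
Proof.
rewrite /holders /tas size_tas filter_iota_ord; congr map.
by apply: eq_enum => t; rewrite !inE nth_map_ord; case: (mu t).
Qed.

Lemma ownE mu (t : 'I_m) :
  own J (matching_input mu) t = bits_of_nat (own_util I mu t).
Proof.
by rewrite /own nth_map_ord /own_util; case: (mu t) => //= x; rewrite utilE.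
Qed.

Lemma avg_utilE mu (x : 'I_n) :
  (threshold I <= avg_util I mu x)%R =
  (`|numq (threshold I)| * capacity I x <=
   `|denq (threshold I)| * \sum_(t in assigned mu x) course_util I x t).
Proof.
rewrite /avg_util mulrC ler_pdivlMr ?ltr0n ?capacity_gt0 //.
by rewrite -natr_sum rat_mul_leq_nat // threshold_ge0.
Qed.

Lemma checkP mu : reflect (MEFE I mu) (check J (matching_input mu)).
Proof.
rewrite /check /courses size_courses all_iota_ord.
have holdE (x : 'I_n) : (binle (bits_of_nat (size (holders J (matching_input mu) x)))
     (cap J x) && binle (cap J x)
     (bits_of_nat (size (holders J (matching_input mu) x)))) =
    (#|assigned mu x| == capacity I x).
  by rewrite !binleE capE !bits_of_natK -eqn_leq holdersE size_map -cardE.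
have sumE (x : 'I_n) : binle (binmul J.2.2.1.1 (cap J x)) (binmul J.2.2.1.2
      (binsum [seq cutil J x t | t <- holders J (matching_input mu) x])) =
    (threshold I <= avg_util I mu x)%R.
  rewrite avg_utilE binleE !binmulE capE binsumE !bits_of_natK holdersE.
  rewrite sumnE !big_map big_enum_cond /=; congr (_ <= _ * _).
  by apply: eq_big => t; rewrite ?andbT // cutilE bits_of_natK.
have envyE (x : 'I_n) (t' : 'I_m) : all (fun t =>
      ~~ (ratle (gr J t' x) (gr J t x) &&
          ~~ binle (util J t x) (own J (matching_input mu) t))) (tas J) =
    [forall t, ~~ ((grade I t' x <= grade I t x)%R &&
                   (own_util I mu t < ta_util I t x))].
  rewrite /tas size_tas all_iota_ord; apply: eq_forallb => t.
  by rewrite ratle_grE binleE utilE ownE !bits_of_natK -ltnNge.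
apply: (iffP forallP) => [chk|[[caps pos] sat ef] x].
  have {}chk x : [/\ #|assigned mu x| = capacity I x,
      (threshold I <= avg_util I mu x)%R &
      forall t', mu t' = Some x -> 0 < ta_util I t' x /\
        forall t, ~~ ((grade I t' x <= grade I t x)%R &&
                   (own_util I mu t < ta_util I t x))].
    have := chk x; rewrite /check_course andbA holdE sumE holdersE.
    case/and3P => /eqP-> -> /allP envy; split=> // t' mut'.
    have : val t' \in [seq val t | t <- enum (assigned mu x)].
      by rewrite mem_map ?mem_enum ?inE ?mut' //; apply: val_inj.
    by move=> /envy; rewrite util_gt0E envyE => /andP[-> /forallP].
  split.
  - split=> [x|t x mut]; first by have [] := chk x.
    by have [_ _ /(_ t mut)[+ _] e] := chk x; rewrite e.
  - by move=> x; have [] := chk x.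
  - move=> [t [t' [x [_ mut' le lt]]]].
    have [_ _ /(_ t' mut')[_ /(_ t)]] := chk x.
    by rewrite le lt.
rewrite /check_course andbA holdE sumE holdersE caps eqxx sat /=.
apply/allP => _ /mapP[t' + ->]; rewrite mem_enum inE => /eqP mut'.
rewrite util_gt0E envyE lt0n; apply/andP; split; first exact/eqP/pos.
apply/forallP => t; apply/negP => /andP[le lt]; apply: ef.
(* The test also ranges over [t = t'], but [t'] holds [x] and cannot prefer it to its own course. *)
exists t, t', x; split=> //; apply: contraTneq lt => ->.
by rewrite -leqNgt /own_util mut'.
Qed.

(* A teaching assistant who is interested in [x] and at least as good as some
   assistant of [x] is assigned, since an unassigned one would be envious. *)
Lemma MEFE_candidate mu t x : MEFE I mu -> mu t = Some x -> candidate C J t x.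
Proof.
move=> [[caps pos] _ ef] mut; rewrite candidateE lt0n.
apply/andP; split; first exact/eqP/pos.
set S := [set _ | _]; apply: (@leq_trans #|\bigcup_x assigned mu x|).
  apply/subset_leq_card/subsetP => t'; rewrite inE => /andP[ut' le].
  case mut': (mu t') => [y|].
    by apply/bigcupP; exists y => //; rewrite inE mut'.
  exfalso; apply: ef; exists t', t, x; split=> //; last by rewrite /own_util mut'.
  by apply: contraTneq isT => tt'; move: mut'; rewrite tt' mut.
(* The assigned assistants number at most the sum of the capacities, each of which is at most
   [C]. *)
apply: (@leq_trans (\sum_x #|assigned mu x|)).
  elim/big_ind2: _ => [||]; rewrite ?cards0 // => A a B b Aa Bb.
  by apply: leq_trans (leq_card_setU _ _) (leq_add Aa Bb).
rewrite (eq_bigr (capacity I)) => [|y _]; last exact: caps.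
by apply: leq_trans (leq_sum _ (fun y _ => capC y)) _; rewrite sum_nat_const card_ord.
Qed.

(* Everyone who is a candidate is counted by the candidate of least grade. *)
Lemma card_candidates (x : 'I_n) :
  #|[set t : 'I_m | candidate C J t x]| <= n * C.
Proof.
have [->|[t1 t1S]] := set_0Vmem [set t : 'I_m | candidate C J t x].
  by rewrite cards0.
case: (Order.TotalTheory.arg_minP (fun t => grade I t x) t1S) => t0 t0S t0min.
have : t0 \in [set t : 'I_m | candidate C J t x] by [].
rewrite inE candidateE => /andP[_]; apply: leq_trans.
apply/subset_leq_card/subsetP => t tS; have := t0min t tS.
by move: tS; rewrite !inE candidateE => /andP[-> _] ->.
Qed.

(** * Counting the assignments, and completeness of the enumeration *)

Lemma size_options t : size (options C J t) =
  (count (fun x => candidate C J t x) (courses J)).+1.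
Proof. by rewrite /options /= size_map size_filter. Qed.

(** Double counting: summed over the courses instead, there are [n] terms, each at most [n * C] by
    [card_candidates]. *)
Lemma sum_candidates :
  \sum_(t <- tas J) count (fun x => candidate C J t x) (courses J) <=
  n * (n * C).
Proof.
rewrite /tas /courses size_tas size_courses.
rewrite -val_enum_ord big_map big_enum /=.
rewrite (eq_bigr (fun t : 'I_m => \sum_(x < n) candidate C J t x)) => [|t _].
  rewrite exchange_big; apply: (@leq_trans (\sum_(x < n) n * C)).
    apply: leq_sum => x _; apply: leq_trans (card_candidates x).
    rewrite -sum1_card [X in _ <= X]big_mkcond /=; apply: eq_leq; apply: eq_bigr => t _.
    by rewrite inE; case: candidate.
  by rewrite sum_nat_const card_ord.
rewrite -val_enum_ord count_map -sum1_count big_enum_cond big_mkcond /=.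
by apply: eq_bigr => x _; case: candidate.
Qed.

(** Size and membership are proved together, because the size bound shows that the cap [2 ^ e] never
    discards the list. The function [h] chooses one option for every assistant. *)
Lemma assignments_complete (e : nat) s (h : nat -> nat) :
  \sum_(t <- s) count (fun x => candidate C J t x) (courses J) <= e ->
  (forall t, t \in s -> h t \in options C J t) ->
  let L := foldr (extend C J (2 ^ e)) [:: [::]] s in
  size L <= 2 ^ (\sum_(t <- s) count (fun x => candidate C J t x) (courses J)) /\
  map h s \in L.
Proof.
elim: s => [|t s IH] /=; first by rewrite big_nil.
rewrite big_cons => le hs.
have [||sL hL] := IH.
- by lia.
- by move=> t' t's; apply: hs; rewrite inE t's orbT.
set L := foldr _ _ _ in sL hL *; rewrite /extend.
set L' := flatten _.
have sL' : size L' <= 2 ^ (count (fun x => candidate C J t x) (courses J) +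
    \sum_(t <- s) count (fun x => candidate C J t x) (courses J)).
  (* An assistant with [a] possible courses has [a.+1 <= 2 ^ a] options. *)
  rewrite size_allpairs size_options expnD mulnC leq_mul //.
  exact: ltn_expl.
rewrite (leq_trans sL') ?leq_pexp2l //; split=> //.
apply/flatten_mapP; exists (map h s) => //.
apply/mapP; exists (h t) => //; apply: hs; exact: mem_head.
Qed.

Lemma MEFE_assignments mu : MEFE I mu ->
  matching_input mu \in assignments C J (2 ^ (n * (n * C))).
Proof.
move=> muP; rewrite /assignments.
have -> : matching_input mu = [seq nth 0 (matching_input mu) t | t <- tas J].
  have e : size J.2.1 = size (matching_input mu).
    by rewrite size_tas /matching_input size_map size_enum_ord.
  by rewrite /tas e -[LHS](mkseq_nth 0).
apply: (assignments_complete sum_candidates _).2 => t.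
rewrite mem_iota size_tas => /= ltm; pose t' := Ordinal ltm.
rewrite -[t]/(val t') nth_map_ord; case mut: (mu t') => [x|]; last exact: mem_head.
rewrite inE /=; apply: map_f; rewrite mem_filter (MEFE_candidate muP mut).
by rewrite mem_iota size_courses /=.
Qed.

(** Entries are at most [n], so each nonzero entry [x.+1] names an actual course and [insub]
    succeeds. *)
Lemma assignments_matching N s : s \in assignments C J N ->
  exists mu, s = matching_input mu.
Proof.
move=> /mem_extend_foldr; rewrite size_iota size_tas size_courses.
case/andP => /eqP sm /allP sn.
exists [ffun t : 'I_m => if nth 0 s t is x.+1 then insub x else None].
apply: (@eq_from_nth _ 0) => [|i]; rewrite sm.
  by rewrite /matching_input size_map size_enum_ord.
move=> im.
rewrite (nth_map_ord 0 _ (Ordinal im)) ffunE /=.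
have := sn (nth 0 s i) (mem_nth 0 _); rewrite sm => /(_ im).
by case: nth => // x xn; rewrite insubT.
Qed.

(** An empty filtered list excludes a MEFE matching, since it would have been enumerated and
    accepted. Otherwise the head represents a matching that passed the test. *)
Lemma solve_correct : exists2 o : option (matching n m),
  enc (solve C (J, 2 ^ (size J.1 * (size J.1 * C)))) = enc_answer o &
  correct_answer I o.
Proof.
rewrite size_courses /solve /=.
case E: [seq mu <- _ | _] => [|s L] /=.
  exists None => // mu muP; have muA := MEFE_assignments muP.
  have /checkP chk := muP.
  have : matching_input mu \in [seq s <- assignments C J (2 ^ (n * (n * C))) |
                                check J s] = false by rewrite E.
  by rewrite mem_filter chk muA.
have : s \in s :: L by exact: mem_head.
rewrite -E mem_filter => /andP[chk /assignments_matching[mu sE]].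
exists (Some mu); last by apply/checkP; rewrite -sE.
by rewrite sE /enc_answer /= -enc_decode.
Qed.

End Correctness.

Theorem theorem10 (r C : nat) :
  exists (f : nat -> nat) (d : nat) (p : program),
    computable f /\
    forall (n m : nat) (I : instance n m),
      (forall x : 'I_n, size (positive_valuations I x) <= r /\ capacity I x <= C) ->
      distinct_grades I ->
      distinct_positive_utils I ->
      exists (o : option (matching n m)) (c : nat),
        [/\ run p (enc_instance I) (enc_answer o) c,
            c <= f n * instance_size I ^ d
          & correct_answer I o].
Proof.
have [p [K [d pP]]] := solve_fpt C.
(* The constants [K] and [d] and the program come from [solve_fpt] and depend only on [C]. *)
exists (fun n => 2 ^ (K * (n * n).+1)), d, p; split; first exact: computable_exp2.
move=> n m I hI _ _.
have [o oE oP] := solve_correct (fun x => (hI x).2).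
have [c run_c cle] := pP (instance_input I).
exists o, c; split=> //; first by rewrite -oE -enc_instance_input.
by rewrite /instance_size -enc_instance_input -{1 2}(size_courses I).
Qed.
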